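(* Let $\beta:Y\to Z$ be a dynamical Belyĭ map with extended monodromy representation $\varphi_\beta:\pi_1^Z\to\pi_1^Y\wr_{E_\beta}\mathrm{Mon}\,\beta$. Let $\gamma:X\to Y$ be any Belyĭ map with monodromy representation $\rho_\gamma:\pi_1^Y\to\mathrm{Mon}\,\gamma\le\mathrm{Sym}(E_\gamma)$, and define $\rho_{\gamma*}:\mathrm{Fun}(E_\beta,\pi_1^Y)\to\mathrm{Fun}(E_\beta,\mathrm{Mon}\,\gamma)$ by $\rho_{\gamma*}(f)=\rho_\gamma\circ f$. Then \[ \varphi_\gamma:=(\rho_{\gamma*}\rtimes\mathrm{id})\circ\varphi_\beta:\pi_1^Z\to\mathrm{Mon}\,\gamma\wr_{E_\beta}\mathrm{Mon}\,\beta \] coincides with the monodromy representation $\rho_{\beta\circ\gamma}$ of $\beta\circ\gamma$, in the sense that, identifying $E_{\beta\circ\gamma}$ with $E_\gamma\times E_\beta$ and letting $(g,\tau)\in\mathrm{Mon}\,\gamma\wr_{E_\beta}\mathrm{Mon}\,\beta$ act by $(e_\gamma,e_\beta)^{(g,\tau)}=(e_\gamma^{g(e_\beta)},e_\beta^{\tau})$, the permutation $\rho_{\beta\circ\gamma}(\lambda)$ is the action of $\varphi_\gamma(\lambda)$ for every $\lambda\in\pi_1^Z$; in particular $\ker\varphi_\gamma=\ker\rho_{\beta\circ\gamma}$ and $\mathrm{Mon}(\beta\circ\gamma)\cong\varphi_\gamma(\pi_1^Z)$.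
   Context: A Belyĭ map is a meromorphic function from a compact Riemann surface to $\mathbb{P}^1(\mathbb{C})$ unbranched outside $\{0,1,\infty\}$; a dynamical Belyĭ map is a Belyĭ map $\beta:\mathbb{P}^1(\mathbb{C})\to\mathbb{P}^1(\mathbb{C})$ with $\beta(\{0,1,\infty\})\subseteq\{0,1,\infty\}$; $Y$, $Z$ denote its domain and codomain; $\beta\circ\gamma$ is then Belyĭ. $\pi_1^Y=\pi_1(Y\setminus\{0,1,\infty\},1/2)$, $\pi_1^Z=\pi_1(Z\setminus\{0,1,\infty\},1/2)$. An edge of a Belyĭ map $h$ is a continuous $e:[0,1]\to h^{-1}([0,1])$ with $h\circ e=\mathrm{id}_{[0,1]}$; $E_h$ is the set of edges. Permutations act on the right and compose left to right; the monodromy representation $\rho_h$ sends a loop $\lambda$ based at $1/2$ to the permutation $e\mapsto e^\lambda$, the edge containing the endpoint of the lift of $\lambda$ by $h$ starting at $e(1/2)$; $\mathrm{Mon}\,h$ is its image. Sheets of $\gamma$: with $B_i$ the path components of $\gamma^{-1}(\mathbb{P}^1(\mathbb{C})\setminus([-\infty,0]\cup[1,\infty]))$ ($[-\infty,0]$ = nonpositive reals with $\infty$) and $\mathscr{T}_i$ the unique path component of $\gamma^{-1}(\overline{\mathbb{H}})$ (closed upper half-plane) meeting $B_i$, the sheets are $B_i\cup\mathscr{T}_i$ minus points over $\{0,1,\infty\}$; each contains exactly one edge of $\gamma$. Identification $E_{\beta\circ\gamma}\leftrightarrow E_\gamma\times E_\beta$: $e\mapsto(e_\gamma,\gamma\circ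 e)$, with $e_\gamma$ the edge of $\gamma$ in the sheet containing $e(1/2)$. Construction: for a path $p$ in $P_*=\mathbb{P}^1(\mathbb{C})\setminus\{0,1,\infty\}$, $\alpha_{p,j}$ ($j=0,1$) is the path from $p(j)$ to $1/2$ which is the upper semicircular arc with diameter between $p(j)$ and $1/2$ if $p(j)\in(-\infty,0)\cup(1,\infty)$, else the straight segment; $p^{\circlearrowleft}=\alpha_{p,0}^{-1}*p*\alpha_{p,1}$. Extending pattern: $f_\lambda:E_\beta\to\pi_1^Y$, $f_\lambda(e_\beta)=\lambda_Y^{\circlearrowleft}$ with $\lambda_Y$ the lift of $\lambda$ by $\beta$ starting at $e_\beta(1/2)$. Wreath products $G\wr_{E_\beta}\mathrm{Mon}\,\beta=\mathrm{Fun}(E_\beta,G)\rtimes\mathrm{Mon}\,\beta$ with $f^\tau(e)=f(e^{\tau^{-1}})$, $(f_1,\tau_1)(f_2,\tau_2)=(f_1\cdot f_2^{\tau_1^{-1}},\tau_1\tau_2)$. Extended monodromy representation: $\varphi_\beta(\lambda)=f_\lambda\rtimes\rho_\beta(\lambda)$; $\rho_{\gamma*}\rtimes\mathrm{id}$ sends $(f,\tau)$ to $(\rho_\gamma\circ f,\tau)$.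
   Formalization: In the definition of sheets, points over 0, 1, ∞ are removed before (not after) taking path components over the closed upper half-plane, since otherwise a sheet may contain several edges (γ = z²); edges lie in sheets up to endpoints, and Belyĭ maps are taken nonconstant. *)

(* Defs.v *)
From HB Require Import structures.
From mathcomp Require Import all_boot all_order all_algebra.
From mathcomp Require Import generic_quotient complex ring lra.
From mathcomp Require Import all_classical all_reals all_analysis.
From mathcomp Require Import homotopy.

Set Implicit Arguments.
Unset Strict Implicit.
Unset Printing Implicit Defensive.

Import Order.TTheory GRing.Theory Num.Theory numFieldNormedType.Exports.
Local Open Scope classical_set_scope.
Local Open Scope ring_scope.
Local Open Scope quotient_scope.

Definition I01 (R : realType) : Type := set_type (`[0, 1]%classic : set R).

HB.instance Definition _ (R : realType) := Topological.on (I01 R).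

Section unit_interval.
Context {R : realType}.
Local Notation I := (I01 R).

Definition rv (t : I) : R := set_val t.

Lemma rvP (t : I) : 0 <= rv t <= 1.
Proof. by have := set_valP t; rewrite /= in_itv. Qed.

Lemma rv_inj : injective rv.
Proof. exact: val_inj. Qed.

Lemma rv_continuous : continuous rv.
Proof. exact: initial_continuous. Qed.

Lemma clamp_subproof (x : R) :
  Num.max 0 (Num.min 1 x) \in (`[0, 1]%classic : set R).
Proof.
rewrite inE /= in_itv /= le_max lexx /= ge_max ler01 /=.
by rewrite ge_min lexx.
Qed.

Definition clamp (x : R) : I :=
  exist (fun y => y \in (`[0, 1]%classic : set R)) _ (clamp_subproof x).

Lemma rv_clamp x : rv (clamp x) = Num.max 0 (Num.min 1 x).
Proof. by []. Qed.

Lemma clampK x : 0 <= x <= 1 -> rv (clamp x) = x.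
Proof. by case/andP=> x0 x1; rewrite rv_clamp (min_r x1) max_r. Qed.

Lemma rvK : cancel rv clamp.
Proof. by move=> t; apply: rv_inj; rewrite clampK ?rvP. Qed.

Lemma clamp_continuous : continuous clamp.
Proof.
apply: continuous_comp_initial => x.
apply: (@continuous_max R R (cst 0) (Num.min 1)); first exact: cvg_cst.
by apply: (@continuous_min R R (cst 1) id); [exact: cvg_cst|exact: cvg_id].
Qed.

Lemma zero_one_subproof : clamp 0 != clamp 1.
Proof.
apply/eqP => /(congr1 rv); rewrite !clampK ?lexx ?ler01// => /eqP.
by rewrite eq_sym oner_eq0.
Qed.

HB.instance Definition _ := @isBiPointed.Build I _ _ zero_one_subproof.

Definition mid : I := clamp 2^-1.

Lemma rv0 : rv zero = 0. Proof. by rewrite clampK ?lexx ?ler01. Qed.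
Lemma rv1 : rv one = 1. Proof. by rewrite clampK ?lexx ?ler01. Qed.
Lemma rv_mid : rv mid = 2^-1. Proof. by rewrite clampK //; lra. Qed.

Lemma clamp_le0 x : x <= 0 -> clamp x = zero.
Proof.
move=> x0; apply: rv_inj; rewrite rv0 rv_clamp.
by rewrite max_l// ge_min x0 orbT.
Qed.

Lemma clamp_ge1 x : 1 <= x -> clamp x = one.
Proof. by move=> x1; apply: rv_inj; rewrite rv1 rv_clamp min_l// max_r. Qed.

Lemma continuous_if (U T : topologicalType) (u : U -> R) (c : R)
    (f g : U -> T) :
    continuous u -> continuous f -> continuous g ->
    (forall x, u x = c -> f x = g x) ->
  continuous (fun x => if u x <= c then f x else g x).
Proof.
move=> cu cf cg fg x A; have [uc|uc|uc] /= := ltgtP (u x) c => Ax;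
  change (nbhs x [set y | A (if u y <= c then f y else g y)]).
- have fx : nbhs x (f @^-1` A) := cf x A Ax.
  have ux : nbhs x (u @^-1` [set y | y < c]) := cu x _ (lt_nbhsl uc).
  by apply: filterS (filterI fx ux) => y /= [Afy uy]; rewrite ltW.
- have gx : nbhs x (g @^-1` A) := cg x A Ax.
  have ux : nbhs x (u @^-1` [set y | c < y]) := cu x _ (lt_nbhsr uc).
  by apply: filterS (filterI gx ux) => y /= [Agy uy]; rewrite leNgt uy.
- have fx : nbhs x (f @^-1` A) := cf x A Ax.
  have gx : nbhs x (g @^-1` A) by apply: cg; rewrite -fg.
  by apply: filterS (filterI fx gx) => y /= [Afy Agy]; case: ifP.
Qed.

Lemma continuous_clamp (U : topologicalType) (u : U -> R) :
  continuous u -> continuous (clamp \o u).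
Proof.
by move=> cu x; apply: continuous_comp; [exact: cu|exact: clamp_continuous].
Qed.

Lemma continuous_affine (U : topologicalType) (u : U -> R) (a b : R) :
  continuous u -> continuous (fun x => a * u x + b).
Proof.
move=> cu x; apply: cvgD; last exact: cvg_cst.
by apply: cvgM; [exact: cvg_cst|exact: cu].
Qed.

Lemma continuous_scale (U : topologicalType) (u : U -> R) (a : R) :
  continuous u -> continuous (fun x => a * u x).
Proof.
by move=> cu x; apply: cvgM; [exact: cvg_cst|exact: cu].
Qed.

Lemma continuous_pair (U V W : topologicalType) (f : U -> V) (g : U -> W) :
  continuous f -> continuous g -> continuous (fun x => (f x, g x)).
Proof. by move=> cf cg x; apply: cvg_pair; [exact: cf|exact: cg]. Qed.

Lemma continuous_o (U V W : topologicalType) (f : U -> V) (g : V -> W) :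
  continuous f -> continuous g -> continuous (g \o f).
Proof. by move=> cf cg x; apply: continuous_comp; [exact: cf|exact: cg]. Qed.

Lemma continuous_rvfst (V : topologicalType) :
  continuous (fun ts : I * V => rv ts.1).
Proof.
apply: (@continuous_o _ _ _ fst rv); last exact: rv_continuous.
by move=> ?; exact: cvg_fst.
Qed.

Lemma continuous_rvsnd (V : topologicalType) :
  continuous (fun ts : V * I => rv ts.2).
Proof.
apply: (@continuous_o _ _ _ snd rv); last exact: rv_continuous.
by move=> ?; exact: cvg_snd.
Qed.
End unit_interval.

Section paths.
Context {R : realType} {T : topologicalType}.
Local Notation I := (I01 R).

Section operations.
Context {x y z : T}.

Definition concat_fun (p q : I -> T) (t : I) : T :=
  if rv t <= 2^-1 then p (clamp (2 * rv t)) else q (clamp (2 * rv t - 1)).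

Lemma concat_fun_continuous (p q : I -> T) :
  continuous p -> continuous q -> p one = q zero -> continuous (concat_fun p q).
Proof.
move=> cp cq pq; apply: continuous_if.
- exact: rv_continuous.
- apply: (@continuous_o _ _ _ (fun t => clamp (2 * rv t)) p) => //.
  apply: (@continuous_clamp _ _ (fun t => 2 * rv t)).
  by apply: continuous_scale; exact: rv_continuous.
- apply: (@continuous_o _ _ _ (fun t => clamp (2 * rv t - 1)) q) => //.
  apply: (@continuous_clamp _ _ (fun t => 2 * rv t - 1)).
  by apply: continuous_affine; exact: rv_continuous.
- by move=> t ->; rewrite clamp_ge1 ?clamp_le0//; lra.
Qed.

Lemma concat_fun0 p q : concat_fun p q zero = p zero.
Proof. by rewrite /concat_fun rv0 invr_ge0 ler0n mulr0 clamp_le0. Qed.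

Lemma concat_fun1 p q : concat_fun p q one = q one.
Proof.
rewrite /concat_fun rv1 ifF; last by apply/negbTE; rewrite -ltNge; lra.
by rewrite clamp_ge1//; lra.
Qed.

Fact concat_continuous (p : {path I from x to y in T})
    (q : {path I from y to z in T}) :
  continuous (concat_fun p q).
Proof.
by apply: concat_fun_continuous; rewrite ?path_one ?path_zero//; exact: cts_fun.
Qed.

Fact concat_zero (p : {path I from x to y in T})
    (q : {path I from y to z in T}) : concat_fun p q zero = x.
Proof. by rewrite concat_fun0 path_zero. Qed.

Fact concat_one (p : {path I from x to y in T})
    (q : {path I from y to z in T}) : concat_fun p q one = z.
Proof. by rewrite concat_fun1 path_one. Qed.

Definition concat (p : {path I from x to y in T})
    (q : {path I from y to z in T}) :
    {path I from x to z in T} :=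
  mk_path (@concat_continuous p q) (concat_zero p q) (concat_one p q).

Lemma concatE p q (t : I) : concat p q t =
  if rv t <= 2^-1 then p (clamp (2 * rv t)) else q (clamp (2 * rv t - 1)).
Proof. by []. Qed.

Definition flip (t : I) : I := clamp (1 - rv t).

Lemma rv_flip (t : I) : rv (flip t) = 1 - rv t.
Proof. by rewrite clampK//; have := rvP t; lra. Qed.

Lemma flip_continuous : continuous flip.
Proof.
have -> : flip = clamp \o (fun t => -1 * rv t + 1).
  by apply/funext => t; rewrite /flip /= mulN1r addrC.
by apply: continuous_clamp; apply: continuous_affine; exact: rv_continuous.
Qed.

Lemma flip0 : flip zero = one.
Proof. by apply: rv_inj; rewrite rv_flip rv0 rv1 subr0. Qed.

Lemma flip1 : flip one = zero.
Proof. by apply: rv_inj; rewrite rv_flip rv0 rv1 subrr. Qed.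

Lemma flipK : involutive flip.
Proof. by move=> t; apply: rv_inj; rewrite !rv_flip subKr. Qed.

Fact reverse_continuous (p : {path I from x to y in T}) :
  continuous (p \o flip).
Proof.
by move=> t; apply: continuous_comp; [exact: flip_continuous|exact: cts_fun].
Qed.

Fact reverse_zero (p : {path I from x to y in T}) : (p \o flip) zero = y.
Proof. by rewrite /= flip0 path_one. Qed.

Fact reverse_one (p : {path I from x to y in T}) : (p \o flip) one = x.
Proof. by rewrite /= flip1 path_zero. Qed.

Definition reverse (p : {path I from x to y in T}) :
    {path I from y to x in T} :=
  mk_path (@reverse_continuous p) (reverse_zero p) (reverse_one p).

Lemma reverseE p (t : I) : reverse p t = p (flip t).
Proof. by []. Qed.

Definition cst_path : {path I from x to x in T} :=
  mk_path (fun t => cvg_cst x) erefl erefl.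

(* Homotopy relative to the endpoints. *)
Definition homotopic (p q : {path I from x to y in T}) : Prop :=
  exists H : I * I -> T,
    [/\ continuous H,
        forall t, H (t, zero) = p t, forall t, H (t, one) = q t,
        forall s, H (zero, s) = x & forall s, H (one, s) = y].

Lemma homotopic_refl (p : {path I from x to y in T}) : homotopic p p.
Proof.
exists (p \o fst); split => //=.
- by move=> ts; apply: continuous_comp; [exact: cvg_fst|exact: cts_fun].
- by move=> _; rewrite path_zero.
- by move=> _; rewrite path_one.
Qed.

Lemma homotopic_sym (p q : {path I from x to y in T}) :
  homotopic p q -> homotopic q p.
Proof.
move=> [H [cH H0 H1 Hx Hy]].
exists (fun ts => H (ts.1, flip ts.2)); split => //=.
- apply: (@continuous_o _ _ _ (fun ts : I * I => (ts.1, flip ts.2)) H) => //.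
  apply: continuous_pair; first by move=> ?; exact: cvg_fst.
  apply: (@continuous_o _ _ _ snd flip) => //; last exact: flip_continuous.
  by move=> ?; exact: cvg_snd.
- by move=> t; rewrite flip0.
- by move=> t; rewrite flip1.
Qed.

Lemma homotopic_trans (q p r : {path I from x to y in T}) :
  homotopic p q -> homotopic q r -> homotopic p r.
Proof.
move=> [H [cH H0 H1 Hx Hy]] [K [cK K0 K1 Kx Ky]].
exists (fun ts => if rv ts.2 <= 2^-1 then H (ts.1, clamp (2 * rv ts.2))
                  else K (ts.1, clamp (2 * rv ts.2 - 1))); split => //=.
- apply: (@continuous_if R (I * I)%type T (fun ts => rv ts.2)).
  + exact: continuous_rvsnd.
  + apply: (@continuous_o _ _ _
      (fun ts : I * I => (ts.1, clamp (2 * rv ts.2))) H) => //.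
    apply: continuous_pair; first by move=> ?; exact: cvg_fst.
    apply: (@continuous_clamp _ _ (fun ts : I * I => 2 * rv ts.2)).
    by apply: continuous_scale; exact: continuous_rvsnd.
  + apply: (@continuous_o _ _ _
      (fun ts : I * I => (ts.1, clamp (2 * rv ts.2 - 1))) K) => //.
    apply: continuous_pair; first by move=> ?; exact: cvg_fst.
    apply: (@continuous_clamp _ _ (fun ts : I * I => 2 * rv ts.2 - 1)).
    by apply: continuous_affine; exact: continuous_rvsnd.
  + by move=> [t s] /= ->; rewrite clamp_ge1 ?clamp_le0 ?H1 ?K0//; lra.
- by move=> t; rewrite rv0 invr_ge0 ler0n mulr0 clamp_le0.
- move=> t; rewrite rv1 ifF; last by apply/negbTE; rewrite -ltNge; lra.
  by rewrite clamp_ge1//; lra.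
- by move=> s; case: ifP.
- by move=> s; case: ifP.
Qed.

End operations.

Arguments concat : simpl never.
Arguments reverse : simpl never.

Lemma homotopic_concat x y z (p p' : {path I from x to y in T})
    (q q' : {path I from y to z in T}) :
  homotopic p p' -> homotopic q q' -> homotopic (concat p q) (concat p' q').
Proof.
move=> [H [cH H0 H1 Hx Hy]] [K [cK K0 K1 Ky Kz]].
exists (fun ts => if rv ts.1 <= 2^-1 then H (clamp (2 * rv ts.1), ts.2)
                  else K (clamp (2 * rv ts.1 - 1), ts.2)); split => //=.
- apply: (@continuous_if R (I * I)%type T (fun ts => rv ts.1)).
  + exact: continuous_rvfst.
  + apply: (@continuous_o _ _ _
      (fun ts : I * I => (clamp (2 * rv ts.1), ts.2)) H) => //.
    apply: continuous_pair; last by move=> ?; exact: cvg_snd.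
    apply: (@continuous_clamp _ _ (fun ts : I * I => 2 * rv ts.1)).
    by apply: continuous_scale; exact: continuous_rvfst.
  + apply: (@continuous_o _ _ _
      (fun ts : I * I => (clamp (2 * rv ts.1 - 1), ts.2)) K) => //.
    apply: continuous_pair; last by move=> ?; exact: cvg_snd.
    apply: (@continuous_clamp _ _ (fun ts : I * I => 2 * rv ts.1 - 1)).
    by apply: continuous_affine; exact: continuous_rvfst.
  + by move=> [t s] /= ->; rewrite clamp_ge1 ?clamp_le0 ?Hy ?Ky//; lra.
- by move=> t; rewrite concatE; case: ifP.
- by move=> t; rewrite concatE; case: ifP.
- by move=> s; rewrite rv0 invr_ge0 ler0n mulr0 clamp_le0.
- move=> s; rewrite rv1 ifF; last by apply/negbTE; rewrite -ltNge; lra.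
  by rewrite clamp_ge1//; lra.
Qed.

Lemma homotopic_reverse x y (p p' : {path I from x to y in T}) :
  homotopic p p' -> homotopic (reverse p) (reverse p').
Proof.
move=> [H [cH H0 H1 Hx Hy]].
exists (fun ts => H (flip ts.1, ts.2)); split => //=.
- apply: (@continuous_o _ _ _ (fun ts : I * I => (flip ts.1, ts.2)) H) => //.
  apply: continuous_pair; last by move=> ?; exact: cvg_snd.
  apply: (@continuous_o _ _ _ fst flip) => //; last exact: flip_continuous.
  by move=> ?; exact: cvg_fst.
- by move=> t; rewrite reverseE.
- by move=> t; rewrite reverseE.
- by move=> s; rewrite flip0.
- by move=> s; rewrite flip1.
Qed.

(* Two reparameterizations of a path by maps of the interval that agree at the
   endpoints are homotopic. *)
Lemma homotopic_reparam (f : I -> T) (phi psi : I -> R) x y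
    (p q : {path I from x to y in T}) :
    continuous f -> continuous phi -> continuous psi ->
    (forall t, p t = f (clamp (phi t))) ->
    (forall t, q t = f (clamp (psi t))) ->
    phi zero = psi zero -> phi one = psi one ->
  homotopic p q.
Proof.
move=> cf cphi cpsi pE qE e0 e1.
exists (fun ts => f (clamp (phi ts.1 + rv ts.2 * (psi ts.1 - phi ts.1)))).
split => /=.
- apply: (@continuous_o _ _ _ _ f) => //.
  apply: (@continuous_clamp _ _
    (fun ts : I * I => phi ts.1 + rv ts.2 * (psi ts.1 - phi ts.1))) => ts.
  have phi1 : {for ts, continuous (fun ts : I * I => phi ts.1)}.
    by apply: (@continuous_o _ _ _ fst phi) => // ?; exact: cvg_fst.
  have psi1 : {for ts, continuous (fun ts : I * I => psi ts.1)}.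
    by apply: (@continuous_o _ _ _ fst psi) => // ?; exact: cvg_fst.
  apply: cvgD; first exact: phi1.
  apply: cvgM; first exact: (@continuous_rvsnd R I ts).
  by apply: cvgD; [exact: psi1|apply: cvgN; exact: phi1].
- by move=> t; rewrite rv0 mul0r addr0 pE.
- by move=> t; rewrite rv1 mul1r addrC subrK qE.
- by move=> s; rewrite e0 subrr mulr0 addr0 -e0 -pE path_zero.
- by move=> s; rewrite e1 subrr mulr0 addr0 -e1 -pE path_one.
Qed.

Lemma continuous_minr (u v : I -> R) :
  continuous u -> continuous v -> continuous (fun t => Num.min (u t) (v t)).
Proof. by move=> cu cv t; apply: continuous_min; [exact: cu|exact: cv]. Qed.

Lemma clamp_congr (f : I -> T) (a b : R) : a = b -> f (clamp a) = f (clamp b).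
Proof. by move=> ->. Qed.

Lemma homotopic_concatA w x y z (p : {path I from w to x in T})
    (q : {path I from x to y in T}) (r : {path I from y to z in T}) :
  homotopic (concat p (concat q r)) (concat (concat p q) r).
Proof.
apply: homotopic_sym.
apply: (@homotopic_reparam (concat p (concat q r))
  (fun t => Num.min (2 * rv t + 0)
     (Num.min (1 * rv t + 4^-1) (2^-1 * rv t + 2^-1))) rv).
- exact: cts_fun.
- by apply: continuous_minr; [|apply: continuous_minr];
    apply: continuous_affine; exact: rv_continuous.
- exact: rv_continuous.
- move=> t; have /andP[t0 t1] := rvP t.
  rewrite !concatE addr0 mul1r.
  have [t2|t2] := leP (rv t) 2^-1; have [t4|t4] := leP (rv t) 4^-1.
  + rewrite min_l; last by rewrite le_min; apply/andP; split; lra.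
    rewrite (@clampK _ (2 * rv t)); last by apply/andP; split; lra.
    by rewrite !ifT//; lra.
  + rewrite (@min_l _ _ (rv t + _)); last by lra.
    rewrite min_r; last by lra.
    rewrite !clampK; try by apply/andP; split; lra.
    rewrite ifF; last by apply/negbTE; rewrite -ltNge; lra.
    rewrite ifF; last by apply/negbTE; rewrite -ltNge; lra.
    rewrite ifT; last by lra.
    by apply: clamp_congr; lra.
  + by exfalso; lra.
  + rewrite (@min_r _ _ (rv t + _)); last by lra.
    rewrite min_r; last by lra.
    rewrite !clampK; try by apply/andP; split; lra.
    rewrite ifF; last by apply/negbTE; rewrite -ltNge; lra.
    rewrite ifF; last by apply/negbTE; rewrite -ltNge; lra.
    by apply: clamp_congr; lra.
- by move=> t; rewrite rvK.
- by rewrite rv0 !mulr0 !add0r min_l// le_min; apply/andP; split; lra.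
- rewrite rv1 !mulr1 [X in Num.min _ X]min_r; last by lra.
  by rewrite min_r; lra.
Qed.

Let lt_half (t : R) : (t <= 2^-1) = false -> 2^-1 < t.
Proof. by move/negbT; rewrite -ltNge. Qed.

Lemma homotopic_concat1p x y (p : {path I from x to y in T}) :
  homotopic (concat cst_path p) p.
Proof.
apply: (@homotopic_reparam p (rv \o (clamp \o (fun t => 2 * rv t - 1))) rv).
- exact: cts_fun.
- apply: (@continuous_o _ _ _ (clamp \o _) rv); last exact: rv_continuous.
  by apply: continuous_clamp; apply: continuous_affine; exact: rv_continuous.
- exact: rv_continuous.
- move=> t; rewrite concatE /= rvK; case: ifPn => // t2.
  by rewrite (@clamp_le0 _ (2 * rv t - 1)) ?path_zero//; lra.
- by move=> t; rewrite rvK.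
- by rewrite /= clamp_le0// rv0; lra.
- by rewrite /= clamp_ge1// rv1; lra.
Qed.

Lemma homotopic_concatp1 x y (p : {path I from x to y in T}) :
  homotopic (concat p cst_path) p.
Proof.
apply: (@homotopic_reparam p (rv \o (clamp \o (fun t => 2 * rv t))) rv).
- exact: cts_fun.
- apply: (@continuous_o _ _ _ (clamp \o _) rv); last exact: rv_continuous.
  by apply: continuous_clamp; apply: continuous_scale; exact: rv_continuous.
- exact: rv_continuous.
- move=> t; rewrite concatE /= rvK; case: ifP => // /lt_half t2.
  by rewrite (@clamp_ge1 _ (2 * rv t)) ?path_one//; lra.
- by move=> t; rewrite rvK.
- by rewrite /= rv0 mulr0 clamp_le0// rv0.
- by rewrite /= clamp_ge1// rv1; lra.
Qed.

Lemma homotopic_concatpV x y (p : {path I from x to y in T}) :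
  homotopic (concat p (reverse p)) cst_path.
Proof.
apply: (@homotopic_reparam p
  (fun t => Num.min (2 * rv t + 0) (- 2 * rv t + 2)) (fun=> 0)).
- exact: cts_fun.
- by apply: continuous_minr; apply: continuous_affine; exact: rv_continuous.
- exact: cst_continuous.
- move=> t; have /andP[t0 t1] := rvP t; rewrite concatE reverseE addr0.
  case: ifP => [t2|/lt_half t2]; first by rewrite min_l//; lra.
  rewrite min_r; last by lra.
  rewrite /flip clampK; last by apply/andP; split; lra.
  by apply: clamp_congr; lra.
- by move=> t; rewrite clamp_le0// path_zero.
- by rewrite rv0 !mulr0 !add0r min_l//; lra.
- by rewrite rv1 !mulr1 addr0 min_r; lra.
Qed.

Lemma reverseK x y (p : {path I from x to y in T}) : reverse (reverse p) = p.
Proof. by apply/path_eqP => t; rewrite !reverseE flipK. Qed.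

Lemma homotopic_concatVp x y (p : {path I from x to y in T}) :
  homotopic (concat (reverse p) p) cst_path.
Proof. by rewrite -{2}(reverseK p); exact: homotopic_concatpV. Qed.

Section fundamental_group.
Variable x : T.
Local Notation loop := {path I from x to x in T}.

Definition homotopicb (p q : loop) : bool := `[< homotopic p q >].

Fact homotopicb_refl : reflexive homotopicb.
Proof. by move=> p; apply/asboolP; exact: homotopic_refl. Qed.

Fact homotopicb_sym : symmetric homotopicb.
Proof. by move=> p q; apply/asboolP/asboolP; exact: homotopic_sym. Qed.

Fact homotopicb_trans : transitive homotopicb.
Proof.
move=> q p r /asboolP pq /asboolP qr; apply/asboolP.
exact: homotopic_trans pq qr.
Qed.

Canonical homotopy_equiv :=
  EquivRel homotopicb homotopicb_refl homotopicb_sym homotopicb_trans.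

Definition pi1 := {eq_quot homotopy_equiv}.

HB.instance Definition _ := Choice.on pi1.
HB.instance Definition _ := EqQuotient.on pi1.

Definition pi1_class (p : loop) : pi1 := \pi p.

Lemma pi1_classP p q : pi1_class p = pi1_class q <-> homotopic p q.
Proof. by split => [/eqmodP/asboolP|pq]; last exact/eqmodP/asboolP. Qed.

Lemma pi1_reprK (c : pi1) : pi1_class (repr c) = c.
Proof. exact: reprK. Qed.

Lemma homotopic_repr p : homotopic (repr (pi1_class p)) p.
Proof. by apply/pi1_classP; rewrite pi1_reprK. Qed.

Definition pi1_mul (a b : pi1) := pi1_class (concat (repr a) (repr b)).
Definition pi1_one := pi1_class (cst_path (x := x)).
Definition pi1_inv (a : pi1) := pi1_class (reverse (repr a)).

Lemma pi1_mulE p q :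
  pi1_mul (pi1_class p) (pi1_class q) = pi1_class (concat p q).
Proof. by apply/pi1_classP; apply: homotopic_concat; exact: homotopic_repr. Qed.

Lemma pi1_invE p : pi1_inv (pi1_class p) = pi1_class (reverse p).
Proof.
by apply/pi1_classP; apply: homotopic_reverse; exact: homotopic_repr.
Qed.

Fact pi1_mulA : associative pi1_mul.
Proof.
move=> a b c; rewrite -(pi1_reprK a) -(pi1_reprK b) -(pi1_reprK c) !pi1_mulE.
by apply/pi1_classP; exact: homotopic_concatA.
Qed.

Fact pi1_mul1 : left_id pi1_one pi1_mul.
Proof.
move=> a; rewrite -(pi1_reprK a) pi1_mulE.
by apply/pi1_classP; exact: homotopic_concat1p.
Qed.

Fact pi1_mulr1 : right_id pi1_one pi1_mul.
Proof.
move=> a; rewrite -(pi1_reprK a) pi1_mulE.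
by apply/pi1_classP; exact: homotopic_concatp1.
Qed.

Fact pi1_mulV : left_inverse pi1_one pi1_inv pi1_mul.
Proof.
move=> a; rewrite -(pi1_reprK a) pi1_invE pi1_mulE.
by apply/pi1_classP; exact: homotopic_concatVp.
Qed.

Fact pi1_mulrV : right_inverse pi1_one pi1_inv pi1_mul.
Proof.
move=> a; rewrite -(pi1_reprK a) pi1_invE pi1_mulE.
by apply/pi1_classP; exact: homotopic_concatpV.
Qed.

HB.instance Definition _ :=
  isGroup.Build pi1 pi1_mulA pi1_mul1 pi1_mulr1 pi1_mulV pi1_mulrV.

End fundamental_group.
End paths.

Arguments pi1 R {T} x.

Section riemann_sphere.
Variable R : realType.
Local Notation I := (I01 R).

Definition C : numClosedFieldType := R[i].

Definition P1 : topologicalType := one_point_compactification C.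

Definition infty : P1 := None.
Definition fin (z : C) : P1 := Some z.
Definition rpt (x : R) : P1 := fin (Complex x 0).

Definition cusps : set P1 := [set infty; fin 0; fin 1].

Definition Pstar : Type := set_type (~` cusps).
HB.instance Definition _ := Topological.on Pstar.

(* The closure is taken in the sphere: infinity belongs to it. *)
Definition closed_upper_half_plane : set P1 :=
  [set z | if z is Some w then 0 <= complex.Im w else True].

Definition slit_plane : set P1 :=
  ~` [set z | z = infty \/ exists2 x, x <= 0 \/ 1 <= x & z = rpt x].

Lemma fin0E : fin 0 = rpt 0. Proof. by []. Qed.
Lemma fin1E : fin 1 = rpt 1. Proof. by []. Qed.

Lemma fin_Pstar (a b : R) : b != 0 \/ (a != 0 /\ a != 1) ->
  fin (Complex a b) \in ~` cusps.
Proof.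
move=> ab; rewrite inE => -[[]//|]; rewrite /fin /=.
- by move=> [aE bE]; move: ab; rewrite aE bE eqxx => -[|[]].
- by move=> [aE bE]; move: ab; rewrite aE bE !eqxx => -[|[]].
Qed.

Fact half_subproof : rpt 2^-1 \in ~` cusps.
Proof.
by apply: fin_Pstar; right; split; [rewrite gt_eqF//|rewrite lt_eqF//]; lra.
Qed.

Definition base_point : Pstar :=
  exist (fun z => z \in ~` cusps) _ half_subproof.

Section connecting_arc.
Variable w : C.
Local Notation x := (complex.Re w).
Local Notation y := (complex.Im w).

(* For w = x real and outside of [0, 1], [arc_to_half] runs along the upper
   half-circle with diameter [x, 1/2] from x to 1/2; c is its center. *)
Definition on_outer_axis : bool := (y == 0) && ((x < 0) || (1 < x)).

Definition segment_to_half (s : R) : C :=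
  Complex ((1 - s) * x + s * 2^-1) ((1 - s) * y).

Definition arc_to_half (s : R) : C :=
  let c := (x + 2^-1) / 2 in
  Complex (c + (x - c) * cos (pi * s)) (`|x - c| * sin (pi * s)).

Definition connecting_arc (s : R) : C :=
  if on_outer_axis then arc_to_half s else segment_to_half s.

Lemma connecting_arc0 : connecting_arc 0 = w.
Proof.
rewrite /connecting_arc; case: ifPn => [/andP[/eqP y0 _]|_].
- rewrite /arc_to_half mulr0 cos0 sin0 mulr1 mulr0 addrC subrK -y0.
  by case: (w).
- by rewrite /segment_to_half subr0 !mul1r mul0r addr0; case: (w).
Qed.

Lemma connecting_arc1 : connecting_arc 1 = Complex 2^-1 0.
Proof.
rewrite /connecting_arc; case: ifP => _.
- rewrite /arc_to_half mulr1 cospi sinpi mulr0.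
  by congr Complex; lra.
- by rewrite /segment_to_half subrr !mul0r mul1r add0r.
Qed.

Lemma connecting_arc_Pstar (s : R) : fin w \in ~` cusps -> 0 <= s <= 1 ->
  fin (connecting_arc s) \in ~` cusps.
Proof.
move=> ws /andP[s0 s1]; have [->|sn0] := eqVneq s 0.
  by rewrite connecting_arc0.
have [->|sn1] := eqVneq s 1; first by rewrite connecting_arc1 half_subproof.
have {s0 sn0}s0 : 0 < s by rewrite lt_neqAle eq_sym sn0.
have {s1 sn1}s1 : s < 1 by rewrite lt_neqAle sn1.
rewrite /connecting_arc; case: ifPn => [/andP[_ xout]|].
- apply: fin_Pstar; left; rewrite mulf_neq0//.
    by rewrite normr_eq0; case/orP: xout => ?; lra.
  rewrite gt_eqF// sin_gt0_pi// mulr_gt0 ?pi_gt0//=.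
  by rewrite gtr_pMr ?pi_gt0.
- rewrite negb_and => /orP yx; apply: fin_Pstar.
  have [y0|yn0] := eqVneq y 0; last first.
    by left; rewrite mulf_neq0// gt_eqF// subr_gt0.
  right; case: yx; first by rewrite y0 eqxx.
  rewrite negb_or -!leNgt => /andP[x0 x1].
  have xn0 : x != 0.
    apply/eqP => x00; move: ws; rewrite inE; apply; left; right.
    by rewrite fin0E; congr Some; move: x00 y0; case: (w) => ? ? /= -> ->.
  have xn1 : x != 1.
    apply/eqP => x00; move: ws; rewrite inE; apply; right.
    by rewrite fin1E; congr Some; move: x00 y0; case: (w) => ? ? /= -> ->.
  have {}x0 : 0 < x by rewrite lt_neqAle eq_sym xn0.
  have {}x1 : x < 1 by rewrite lt_neqAle xn1.
  by split; [rewrite gt_eqF//|rewrite lt_eqF//]; nra.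
Qed.
End connecting_arc.

Lemma ler_normC (z : C) : `|z| <= Complex (`|complex.Re z| + `|complex.Im z|) 0.
Proof.
case: z => a b; rewrite [`|_|]normc_def /=.
rewrite lecE /= eqxx /=.
have -> : `|a| + `|b| = Num.sqrt ((`|a| + `|b|) ^+ 2).
  by rewrite sqrtr_sqr [RHS]ger0_norm// addr_ge0.
rewrite ler_wsqrtr// sqrrD !real_normK ?num_real//.
by rewrite lerD2r lerDl mulrn_wge0// mulr_ge0.
Qed.

Lemma continuous_Complex (U : topologicalType) (a b : U -> R) :
  continuous a -> continuous b -> continuous (fun u => Complex (a u) (b u) : C).
Proof.
move=> ca cb u; apply/(@cvgrPdist_lt C C) => e e0.
have e0' : 0 < complex.Re e / 2.
  move: e0; case: (e) => e1 e2; rewrite ltcE/= => /andP[_ ?].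
  by rewrite divr_gt0.
have /(@cvgrPdist_lt R R)/(_ _ e0') ua := ca u.
have /(@cvgrPdist_lt R R)/(_ _ e0') ub := cb u.
apply: filterS (filterI ua ub) => v [av bv].
apply: le_lt_trans (ler_normC _) _.
move: e0 av bv; case: (e) => e1 e2; rewrite !ltcE/= => /andP[/eqP -> _] av bv.
by rewrite eqxx/=; lra.
Qed.

Lemma connecting_arc_continuous w : continuous (connecting_arc w \o @rv R).
Proof.
have crv := @rv_continuous R.
have crest a b : continuous (fun t : I => a * rv t + b).
  exact: continuous_affine.
have [h|h] := boolP (on_outer_axis w); last first.
- have -> : connecting_arc w = segment_to_half w.
    by apply/funext => s; rewrite /connecting_arc (negbTE h).
  have -> : (segment_to_half w) \o rv = fun t : I =>
      Complex ((2^-1 - complex.Re w) * rv t + complex.Re w)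
              (- complex.Im w * rv t + complex.Im w).
    by apply/funext => t; rewrite /segment_to_half /=; congr Complex; ring.
  exact: continuous_Complex.
- have -> : connecting_arc w = arc_to_half w.
    by apply/funext => s; rewrite /connecting_arc h.
  have -> : arc_to_half w \o rv = fun t : I =>
      let c := (complex.Re w + 2^-1) / 2 in
      Complex ((complex.Re w - c) * cos (pi * rv t) + c)
              (`|complex.Re w - c| * sin (pi * rv t)).
    by apply/funext => t; rewrite /arc_to_half /= addrC.
  have cpi : continuous (fun t : I => pi * rv t) by exact: continuous_scale.
  apply: continuous_Complex.
  + apply: continuous_affine.
    by apply: (@continuous_o _ _ _ _ cos) => //; exact: continuous_cos.
  + apply: continuous_scale.
    by apply: (@continuous_o _ _ _ _ sin) => //; exact: continuous_sin.
Qed.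

Section alpha.
Variable z : Pstar.

Definition coord (z : P1) : C := odflt 0 z.

Lemma fin_coord : fin (coord (set_val z)) = set_val z.
Proof.
have : (~` cusps) (set_val z) := set_valP z.
by rewrite /coord; case: (set_val z) => [w|] nz //; case: nz; left; left.
Qed.

Fact alpha_subproof (t : I) :
  fin (connecting_arc (coord (set_val z)) (rv t)) \in ~` cusps.
Proof.
by apply: connecting_arc_Pstar (rvP t); rewrite fin_coord; exact: valP z.
Qed.

Definition alpha_fun (t : I) : Pstar :=
  exist (fun z => z \in ~` cusps) _ (alpha_subproof t).

Fact alpha_continuous : continuous alpha_fun.
Proof.
apply: continuous_comp_initial.
apply: (@continuous_o _ _ _ (connecting_arc (coord (set_val z)) \o @rv R) fin).
  exact: connecting_arc_continuous.
exact: one_point_compactification_some_continuous.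
Qed.

Fact alpha_zero : alpha_fun zero = z.
Proof. by apply: val_inj; rewrite /= rv0 connecting_arc0 fin_coord. Qed.

Fact alpha_one : alpha_fun one = base_point.
Proof. by apply: val_inj; rewrite /= rv1 connecting_arc1. Qed.

Definition alpha : {path I from z to base_point in Pstar} :=
  mk_path alpha_continuous alpha_zero alpha_one.
End alpha.

(* The loop written p^{\circlearrowleft}; [alpha a] goes from a to 1/2. *)
Definition loop_of (a b : Pstar) (p : {path I from a to b in Pstar}) :
    {path I from base_point to base_point in Pstar} :=
  concat (concat (reverse (alpha a)) p) (alpha b).

End riemann_sphere.

Arguments infty {R}.
Arguments cusps {R}.
Arguments closed_upper_half_plane {R}.
Arguments slit_plane {R}.
Arguments base_point {R}.

(* Holomorphic functions, in the sense of Weierstrass: sums of a convergent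
   power series near every point. *)
Definition holomorphic_at (R : realType) (f : C R -> C R) (z : C R) : Prop :=
  exists (c : nat -> C R) (r : C R), 0 < r /\
    forall w : C R, `|w - z| < r ->
      series (fun n => c n * (w - z) ^+ n) @ \oo --> f w.

(* The values of [cfun] outside of [cdom], and those of [cinv] outside of the
   image of [cdom], are irrelevant. *)
Record chart (R : realType) (X : Type) := Chart {
  cdom : set X;
  cfun : X -> C R;
  cinv : C R -> X
}.

Section riemann_surface.
Variables (R : realType).
Implicit Types X Y : topologicalType.

Definition is_chart X (a : chart R X) : Prop :=
  [/\ open (cdom a),
      open (cfun a @` cdom a),
      forall x, cdom a x -> cinv a (cfun a x) = x,
      forall x, cdom a x -> {for x, continuous (cfun a)} &
      forall z, (cfun a @` cdom a) z -> {for z, continuous (cinv a)}].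

Definition holomorphic_map X Y (A : set (chart R X)) (B : set (chart R Y))
    (f : X -> Y) : Prop :=
  continuous f /\
  forall a b, A a -> B b ->
    forall x, cdom a x -> cdom b (f x) ->
      holomorphic_at (cfun b \o f \o cinv a) (cfun a x).

Definition riemann_surface X (A : set (chart R X)) : Prop :=
  [/\ hausdorff_space X /\ connected [set: X],
      forall a, A a -> is_chart a,
      forall x, exists2 a, A a & cdom a x &
      forall a b, A a -> A b ->
        forall x, cdom a x -> cdom b x ->
          holomorphic_at (cfun b \o cinv a) (cfun a x)].

Definition compact_riemann_surface X (A : set (chart R X)) : Prop :=
  riemann_surface A /\ compact [set: X].

(* The coordinate z on the complement of infinity. *)
Definition finite_chart : chart R (P1 R) :=
  Chart [set z | z <> infty] (@coord R) (@fin R).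

(* The coordinate 1/z on the complement of 0. *)
Definition infinite_chart : chart R (P1 R) :=
  Chart [set z | z <> fin 0] (fun z => if z is Some w then w^-1 else 0)
    (fun w => if w == 0 then infty else fin w^-1).

Definition P1_atlas : set (chart R (P1 R)) :=
  [set finite_chart; infinite_chart].

Definition local_homeomorphism_at X Y (f : X -> Y) (x : X) : Prop :=
  exists U : set X, [/\ open U, U x, {in U &, injective f} &
    forall V, open V -> V `<=` U -> open (f @` V)].

(* Constant maps are excluded; [f] is unbranched at [x] when it is a local
   homeomorphism there. *)
Definition belyi X (A : set (chart R X)) (h : X -> P1 R) : Prop :=
  [/\ holomorphic_map A P1_atlas h,
      exists x y, h x <> h y &
      forall x, ~ cusps (h x) -> local_homeomorphism_at h x].

Definition dynamical_belyi (b : P1 R -> P1 R) : Prop :=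
  belyi P1_atlas b /\ b @` cusps `<=` cusps.

End riemann_surface.

Record Sym (E : Type) := MkSym {
  sfun :> E -> E;
  sinv : E -> E;
  sfunK : cancel sfun sinv;
  sinvK : cancel sinv sfun
}.

HB.instance Definition _ (E : Type) := gen_eqMixin (Sym E).
HB.instance Definition _ (E : Type) := gen_choiceMixin (Sym E).

Section sym_group.
Variable E : Type.

Lemma symP (s t : Sym E) : sfun s =1 sfun t -> s = t.
Proof.
case: s t => [f f' fK f'K] [g g' gK g'K] /= /funext fg.
rewrite -{}fg in gK g'K *.
have f'g' : f' = g' by apply/funext => x; rewrite -{1}(g'K x) fK.
rewrite -{}f'g' in gK g'K *.
by rewrite (Prop_irrelevance fK gK) (Prop_irrelevance f'K g'K).
Qed.

Definition sym_one : Sym E := @MkSym E id id (fun=> erefl) (fun=> erefl).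

Definition sym_inv (s : Sym E) : Sym E := MkSym (sinvK s) (sfunK s).

(* Permutations compose from left to right. *)
Definition sym_mul (s t : Sym E) : Sym E :=
  @MkSym E (sfun t \o sfun s) (sinv s \o sinv t)
    (can_comp (sfunK t) (sfunK s)) (can_comp (sinvK s) (sinvK t)).

Fact sym_mulA : associative sym_mul. Proof. by move=> s t u; apply: symP. Qed.
Fact sym_mul1 : left_id sym_one sym_mul. Proof. by move=> s; apply: symP. Qed.
Fact sym_mulr1 : right_id sym_one sym_mul. Proof. by move=> s; apply: symP. Qed.
Fact sym_mulV : left_inverse sym_one sym_inv sym_mul.
Proof. by move=> s; apply: symP => x; exact: sinvK. Qed.
Fact sym_mulrV : right_inverse sym_one sym_inv sym_mul.
Proof. by move=> s; apply: symP => x; exact: sfunK. Qed.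

HB.instance Definition _ :=
  isGroup.Build (Sym E) sym_mulA sym_mul1 sym_mulr1 sym_mulV sym_mulrV.
End sym_group.

(* The full wreath product of G by Sym(E); the wreath product of G by a
   subgroup of Sym(E) is one of its subgroups, see [wreath_set]. *)
Record wreath (E : Type) (G : Type) := Wreath {
  wfun : E -> G;
  wperm : Sym E
}.

HB.instance Definition _ (E G : Type) := gen_eqMixin (wreath E G).
HB.instance Definition _ (E G : Type) := gen_choiceMixin (wreath E G).

Section wreath_group.
Variables (E : Type) (G : groupType).
Local Notation W := (wreath E G).
Local Open Scope group_scope.

(* f^tau, sending e to f(e^(tau^-1)) *)
Definition fun_act (f : E -> G) (tau : Sym E) : E -> G := fun e => f (tau^-1 e).

Definition wreath_one : W := Wreath (fun=> 1) 1.

Definition wreath_mul (v w : W) : W :=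
  Wreath (fun e => wfun v e * fun_act (wfun w) (wperm v)^-1 e)
         (wperm v * wperm w).

Definition wreath_inv (v : W) : W :=
  Wreath (fun_act (fun e => (wfun v e)^-1) (wperm v)) (wperm v)^-1.

Lemma wreathP (v w : W) : wfun v =1 wfun w -> wperm v = wperm w -> v = w.
Proof. by case: v w => [f s] [g t] /= /funext -> ->. Qed.

Fact wreath_mulA : associative wreath_mul.
Proof. by move=> u v w; apply: wreathP => [e|] /=; rewrite mulgA. Qed.

Fact wreath_mul1 : left_id wreath_one wreath_mul.
Proof. by move=> u; apply: wreathP => [e|] /=; rewrite mul1g. Qed.

Fact wreath_mulr1 : right_id wreath_one wreath_mul.
Proof. by move=> u; apply: wreathP => [e|] /=; rewrite mulg1. Qed.

Fact wreath_mulV : left_inverse wreath_one wreath_inv wreath_mul.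
Proof.
by move=> u; apply: wreathP => [e|] /=; rewrite /fun_act /= mulVg.
Qed.

Fact wreath_mulrV : right_inverse wreath_one wreath_inv wreath_mul.
Proof.
move=> u; apply: wreathP => [e|] /=; rewrite ?mulgV//.
by rewrite /fun_act /= sfunK mulgV.
Qed.

HB.instance Definition _ := isGroup.Build W
  wreath_mulA wreath_mul1 wreath_mulr1 wreath_mulV wreath_mulrV.

Definition wreath_set (A : set G) (M : set (Sym E)) : set W :=
  [set w | (forall e, A (wfun w e)) /\ M (wperm w)].
End wreath_group.

(* (f, tau) is sent to (r o f, tau). *)
Definition wreath_map (E G H : Type) (r : G -> H) (w : wreath E G) :
  wreath E H := Wreath (r \o wfun w) (wperm w).

Definition wreath_act (E F : Type) (w : wreath F (Sym E)) (p : E * F) : E * F :=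
  (wfun w p.2 p.1, wperm w p.2).

Definition group_kernel (G : Type) (H : groupType) (f : G -> H) : set G :=
  [set x | f x = 1%g].

Section monodromy.
Variable R : realType.
Local Notation I := (I01 R).
Local Notation group := (pi1 R (@base_point R)).

Section edges.
Variables (X : topologicalType) (h : X -> P1 R).

Record edge := Edge {
  edge_fun :> I -> X;
  edge_continuous : continuous edge_fun;
  edge_section : forall t, h (edge_fun t) = rpt (rv t)
}.

Definition is_lift (p : I -> Pstar R) (q : I -> X) : Prop :=
  continuous q /\ forall t, h (q t) = set_val (p t).

Definition monodromy_spec (l : group) (s : Sym edge) : Prop :=
  forall e : edge, exists q : I -> X,
    [/\ is_lift (repr l) q, q zero = e mid & range (s e) (q one)].

(* When h is a Belyi map, exactly one permutation satisfies [monodromy_spec];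
   it does not depend on the representative of the class l. *)
Definition rho (l : group) : Sym edge := xget 1%g [set s | monodromy_spec l s].

Definition Mon : set (Sym edge) := range rho.

Definition path_component (A : set X) (x : X) : set X :=
  [set y | exists p : {path I from x to y in X}, forall t, A (p t)].

Definition is_path_component (A B : set X) : Prop :=
  exists2 x, A x & B = path_component A x.

(* The points over 0, 1, infinity have to be removed before taking the path
   components over the closed half-plane, which would otherwise be glued
   together at these points. *)
Definition is_sheet (S : set X) : Prop :=
  exists B T : set X,
    [/\ is_path_component (h @^-1` slit_plane) B,
        is_path_component
          (h @^-1` (closed_upper_half_plane `\` cusps)) T,
        B `&` T !=set0 &
        S = (B `|` T) `\` h @^-1` cusps].

(* An edge is contained in a sheet up to its two endpoints, which lie over 0
   and 1. *)
Definition edge_in_sheet (e : edge) (S : set X) : Prop :=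
  forall t : I, 0 < rv t < 1 -> S (e t).

Definition edge_of_sheet_at (x : X) (e : edge) : Prop :=
  exists S : set X, [/\ is_sheet S, S x & edge_in_sheet e S].

End edges.

Section extended.
Variable beta : P1 R -> P1 R.

(* For a dynamical Belyi map beta, the lift of l starting at e(1/2) exists, is
   unique and avoids 0, 1, infinity, and the class c only depends on l and e. *)
Definition extending_pattern (l : group) (e : edge beta) : group :=
  xget 1%g [set c |
    exists (a b : Pstar R) (q : {path I from a to b in Pstar R}),
    [/\ is_lift beta (repr l) (fun t => set_val (q t)),
        set_val (q zero) = e mid & c = pi1_class (loop_of q)]].

Definition extended_monodromy (l : group) : wreath (edge beta) group :=
  Wreath (extending_pattern l) (rho beta l).

End extended.

(* iota maps e to (e_gamma, gamma o e), e_gamma being the only edge of gamma in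
   the sheet containing e(1/2). *)
Definition edge_identification (X : topologicalType) (beta : P1 R -> P1 R)
    (gamma : X -> P1 R)
    (iota : edge (beta \o gamma) -> edge gamma * edge beta) : Prop :=
  forall e : edge (beta \o gamma),
    (forall e' : edge gamma,
       edge_of_sheet_at (e mid) e' <-> e' = (iota e).1) /\
    (forall t, (iota e).2 t = gamma (e t)).

End monodromy.

Arguments Mon {R X} h.

(* Main.v *)
(* A Belyi map is a branched cover: over the complement of the cusps it is a
   local homeomorphism with compact source, and by the identity theorem for power
   series its fibers are discrete. Hence a path avoiding the cusps, except
   possibly at its end, has a unique lift from each starting point, and the end
   of the lift is locally constant in continuous families of paths with a fixed
   end.

   Write E x for the end of the lift by gamma of the arc from gamma x to 1/2.
   The slit plane is star-shaped about 1/2 and the closed upper half-plane is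
   star-shaped about i, so E is constant on each sheet; thus the edge of gamma in
   the sheet of x is the one whose midpoint is E x. If q lifts a loop l by
   beta o gamma, then gamma o q is the lift p of l by beta, and the lift of the
   loop p^{\circlearrowleft} by gamma from E (q 0) runs back to q 0, along q, and on to
   E (q 1): this is the asserted equivariance. The wreath product acts faithfully on
   pairs of edges, so the group-theoretic claims follow from the equivariance. *)
Require Import Defs.
From HB Require Import structures.
From mathcomp Require Import all_boot all_order all_algebra.
From mathcomp Require Import generic_quotient complex ring lra.
From mathcomp Require Import all_classical all_reals all_analysis.
From mathcomp Require Import homotopy.

Set Implicit Arguments.
Unset Strict Implicit.
Unset Printing Implicit Defensive.

Import Order.TTheory GRing.Theory Num.Theory numFieldNormedType.Exports.
Local Open Scope classical_set_scope.
Local Open Scope ring_scope.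
Local Open Scope quotient_scope.

(** * Lifting paths along branched covers *)

(** Connectedness as an induction principle: near each point of [D], the property [P] holds
    throughout [D] or nowhere in it, so its locus is relatively open and closed. All passages from
    local to global below go through it. *)
Lemma connected_ind (T : topologicalType) (D P : set T) :
    connected D ->
    (forall s, D s -> exists2 M, nbhs s M &
      forall s1 s2, M s1 -> M s2 -> D s1 -> D s2 -> P s1 -> P s2) ->
  forall s1 s2, D s1 -> D s2 -> P s1 -> P s2.
Proof.
move=> cD loc s1 s2 D1 D2 P1.
suff E : D `&` P = D by move: D2; rewrite -E => -[].
apply: cD; first by exists s1.
(* The implication turns the locus of [P] in [D] into a set of the ambient space, whose interior has
   the right trace on [D]. *)
- exists (interior [set s | D s -> P s]); first exact: open_interior.
  apply/seteqP; split => s [Ds] => [Ps|/interior_subset Ps]; last first.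
    by split => //; exact: Ps.
  split=> //; have [M Ms MP] := loc s Ds; have Mss := nbhs_singleton Ms.
  by apply: filterS Ms => t Mt Dt; apply: (MP s t) => //.
- exists (~` interior [set s | D s -> ~ P s]).
    by apply: open_closedC; exact: open_interior.
  apply/seteqP; split => s [Ds] => [Ps|nPs]; split=> //.
    by move=> /interior_subset /(_ Ds).
  apply: contrapT => Ps; apply: nPs.
  have [M Ms MP] := loc s Ds; have Mss := nbhs_singleton Ms.
  apply: filterS Ms => t Mt Dt Pt; apply: Ps.
  by apply: (MP t s) => //.
Qed.

Lemma hausdorff_near_neq (T X : topologicalType) (q q' : T -> X) (t : T) :
    hausdorff_space X -> {for t, continuous q} -> {for t, continuous q'} ->
    q t <> q' t ->
  \forall s \near t, q s <> q' s.
Proof.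
move=> hX cq cq' /eqP; move: (hX); rewrite open_hausdorff => sep /sep.
move=> [[U V] /= [/set_mem Uq /set_mem Vq] [oU oV /eqP UV0]].
have qU : nbhs t (q @^-1` U) by apply: cq; exact: open_nbhs_nbhs.
have qV : nbhs t (q' @^-1` V) by apply: cq'; exact: open_nbhs_nbhs.
apply: filterS (filterI qU qV) => s [Us Vs] e.
by have UVs : (U `&` V) (q s) by [split=> //; rewrite e]; rewrite UV0 in UVs.
Qed.

Section branched_cover.
Variables (R : realType) (X Y : topologicalType).
Implicit Types (h : X -> Y) (K : set Y).

Definition isolated_fibers h : Prop :=
  forall x, \forall x' \near x, h x' = h x -> x' = x.

(** The topological content of being a Belyi map, with branching allowed only over [K]. Stated
    without charts, it serves [beta], [gamma] and their composition alike. *)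
Definition branched_cover K h : Prop :=
  [/\ hausdorff_space X, compact [set: X], continuous h,
      forall x, ~ K (h x) -> local_homeomorphism_at h x & isolated_fibers h].

(** Agreement of two lifts is an open condition by local injectivity of [h] off [K], and a closed
    one because X is Hausdorff. *)
Lemma unique_lift K h (T : topologicalType) (D : set T) (q q' : T -> X) :
    branched_cover K h -> connected D -> continuous q -> continuous q' ->
    (forall t, D t -> h (q t) = h (q' t)) ->
    (forall t, D t -> ~ K (h (q t))) ->
  forall s t, D s -> D t -> q s = q' s -> q t = q' t.
Proof.
move=> [hX _ _ lh _] cD cq cq' hqq' nK.
apply: (@connected_ind _ D (fun t => q t = q' t)) => // t Dt.
have [qq'|/(hausdorff_near_neq hX (cq t) (cq' t)) ne] := pselect (q t = q' t).
  have [U [oU Ux inj _]] := lh _ (nK _ Dt).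
  have qU : nbhs t (q @^-1` U) by apply: cq; exact: open_nbhs_nbhs.
  have q'U : nbhs t (q' @^-1` U).
    by apply: cq'; rewrite -qq'; exact: open_nbhs_nbhs.
  exists (q @^-1` U `&` q' @^-1` U); first exact: filterI.
  move=> s1 s2 _ [Us Us'] _ Ds _; apply: inj; rewrite ?inE//.
  exact: hqq'.
(* The lifts agree nowhere on this neighborhood, so there is nothing to propagate. *)
by exists [set s | q s <> q' s].
Qed.

(** On [U] the map [h] is injective and open, so its inverse is continuous; [q] is this inverse
    composed with [r]. *)
Lemma local_section_continuous h (T : topologicalType) (U : set X)
    (r : T -> Y) (q : T -> X) :
    open U -> {in U &, injective h} ->
    (forall V, open V -> V `<=` U -> open (h @` V)) ->
    (forall t, U (q t) /\ h (q t) = r t) -> forall t,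
    {for t, continuous r} -> {for t, continuous q}.
Proof.
move=> oU inj op qr t cr N; rewrite nbhsE => -[N' [oN' N't] N'N].
have [Ut ht] := qr t.
have : nbhs (r t) (h @` (U `&` N')).
  apply: open_nbhs_nbhs; split; first by apply: op; [exact: openI|move=> ? []].
  by exists (q t).
move=> /cr rV; change (nbhs t (q @^-1` N)).
apply: filterS (rV : nbhs t (r @^-1` _)) => s /= [u [Uu N'u] hu].
have [Us hs] := qr s.
by apply: N'N; suff <- : u = q s by []; apply: inj; rewrite ?inE// hs.
Qed.

(* A limit point p of the lift exists by compactness. A small neighborhood O of
   p has a boundary avoiding the fiber of p, so that the lift, near s, does not
   cross this boundary: it stays in O. *)
Lemma lift_limit K h (W : R -> X) (g : R -> Y) (a s : R) :
    hausdorff_space Y -> branched_cover K h -> a < s ->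
    (forall t, a < t < s -> {for t, continuous W}) ->
    (forall t, a < t < s -> h (W t) = g t) ->
    {for s, continuous g} ->
  exists2 x, W @ s^'- --> x & h x = g s.
Proof.
move=> hY [hX cX ch _ iso] lt_as cW hW cg.
have near_s : \forall t \near s^'-, a < t < s.
  near=> t; apply/andP; split; near: t; [exact: nbhs_left_gt|exact: nbhs_left_lt].
have gs : g @ s^'- --> g s by apply: cvg_within_filter; exact: cg.
have [p [_ clp]] := cX (W @ s^'-) _ filterT.
have hp : h p = g s.
  symmetry; apply: hY => B B' Bg B'p.
  have FB : (W @ s^'-) (h @^-1` B).
    apply: filterS (filterI near_s (gs _ Bg)) => t [at_ Bt] /=.
    by rewrite hW.
  by have [z [Bz B'z]] := clp _ _ FB (ch p _ B'p); exists (h z).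
exists p => // N Np.
(* The isolation of p in its fiber is built into the neighborhood, so that no boundary point of the
   set [O] chosen inside it lies over [h p]. *)
have Np' : nbhs p (N `&` [set x | h x = h p -> x = p]).
  by apply: filterI => //; exact: iso.
have cpt_reg : {for p, regular_space X}.
  by apply: (@compact_regular _ p setT) => //; exact: filterT.
have [Z Zp clZ] := cpt_reg _ Np'.
pose O := interior Z.
have clO : closure O `<=` closure Z by apply: closureS; exact: interior_subset.
have oO : open O by exact: open_interior.
have Op : nbhs p O by apply: open_nbhs_nbhs; split.
have cbd : closed (h @` (closure O `\` O)).
  apply: compact_closed => //; apply: continuous_compact.
    exact: continuous_subspaceT.
  apply: subclosed_compact cX _ => //.
  by apply: closedI; [exact: closed_closure|exact: open_closedC].
have gbd : nbhs (g s) (~` (h @` (closure O `\` O))).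
  apply: open_nbhs_nbhs; split; first exact: closed_openC.
  move=> [x [/clO /clZ [_ xp] nOx] hx]; apply: nOx.
  by rewrite xp ?hx//; exact: nbhs_singleton.
have [d d0 dP] : exists2 d, 0 < d & forall t, s - d < t < s ->
    a < t < s /\ ~ (closure O `\` O) (W t).
  have : \forall t \near s, t < s -> a < t < s /\ ~ (h @` (closure O `\` O)) (g t).
    exact: filterI near_s (gs _ gbd).
  move=> /nbhs_ballP[d /= d0 dP]; exists d => // t /andP[t1 t2].
  have [] := dP t _ t2; rewrite /ball/=.
    by rewrite gtr0_norm; lra.
  move=> ats /= nbd; split=> // bd; apply: nbd; exists (W t) => //; exact: hW.
have cJ : connected [set` `]s - d, s[].
  by apply/connected_intervalP; exact: interval_is_interval.
have FJ : (W @ s^'-) (W @` [set` `]s - d, s[]).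
  change (\forall t \near s^'-, (W @` [set` `]s - d, s[]) (W t)).
  near=> t; exists t => //=; rewrite in_itv/=; apply/andP; split; near: t.
    by apply: nbhs_left_gt; rewrite ltrBlDr ltrDl.
  exact: nbhs_left_lt.
have [_ [[t1 t1J <-] Ot1]] := clp (W @` [set` `]s - d, s[]) O FJ Op.
have JO t : s - d < t < s -> O (W t).
  move=> tJ; move: t1J => /=; rewrite in_itv/= => t1J.
  apply: (@connected_ind _ [set` `]s - d, s[] (O \o W) cJ _ t1 t) => //=;
    rewrite ?in_itv//= => u; rewrite in_itv/= => uJ.
  have [au nbd] := dP _ uJ.
  have [Ou|nOu] := pselect (O (W u)).
    exists (W @^-1` O) => //; apply: cW => //; exact: open_nbhs_nbhs.
  exists (W @^-1` ~` closure O).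
    apply: cW => //; apply: open_nbhs_nbhs; split.
      by apply: closed_openC; exact: closed_closure.
    by move=> clOu; apply: nbd.
  by move=> ? ? /= nO _ _ _ /subset_closure.
change (\forall t \near s^'-, N (W t)).
near=> t; apply: (clZ _ _).1.
apply: clO; apply: subset_closure; apply: JO; apply/andP; split; near: t.
  by apply: nbhs_left_gt; rewrite ltrBlDr ltrDl.
exact: nbhs_left_lt.
Unshelve. all: by end_near. Qed.

Let itv01 (s : R) : connected [set` `[0, s]].
Proof. by apply/connected_intervalP; exact: interval_is_interval. Qed.

Lemma lift_extend h (g : R -> Y) (q : R -> X) (s : R) :
    0 <= s -> continuous g -> continuous q ->
    (forall t, 0 <= t <= s -> h (q t) = g t) ->
    local_homeomorphism_at h (q s) ->
  exists2 e, 0 < e & exists q' : R -> X, [/\ continuous q', q' 0 = q 0 &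
    forall t, 0 <= t <= s + e -> h (q' t) = g t].
Proof.
move=> s0 cg cq hq [U [oU Us inj op]].
have : nbhs s (g @^-1` (h @` U)).
  apply: cg; apply: open_nbhs_nbhs; split; first exact: op.
  by exists (q s) => //; rewrite hq// s0 lexx.
move=> /nbhs_ballP[e0 /= e00 gU]; pose e := e0 / 2; exists e.
  by rewrite divr_gt0.
(* Time is truncated to the interval from s to s + e, on which g stays in the image of [U]; the
   local section is then defined for every real t. *)
pose r t := g (Num.max s (Num.min t (s + e))).
have e_gt0 : 0 < e by rewrite divr_gt0.
have e_lt : e < e0 by rewrite /e; lra.
have rU t : exists u, U u /\ h u = r t.
  have [u Uu hu] : (h @` U) (r t); last by exists u.
  apply: gU; rewrite /ball/=.
  have st : s <= Num.max s (Num.min t (s + e)) by rewrite le_max lexx.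
  have ts : Num.max s (Num.min t (s + e)) <= s + e.
    by rewrite ge_max ge_min lexx orbT andbT; lra.
  by rewrite ler0_norm; lra.
have [v vP] := choice rU.
have cr : continuous r.
  apply: (@continuous_o _ _ _ (fun t => Num.max s (Num.min t (s + e))) g) => // t.
  apply: (@continuous_max R R (cst s) (fun t => Num.min t (s + e))).
    exact: cvg_cst.
  by apply: (@continuous_min R R id (cst (s + e))); [exact: cvg_id|exact: cvg_cst].
have cv : continuous v.
  by move=> t; apply: (local_section_continuous oU inj op vP); exact: cr.
exists (fun t => if t <= s then q t else v t); split.
- apply: (@continuous_if R R X id) => //; first by move=> t; exact: cvg_id.
  move=> t /= ->; have [Uv hv] := vP s.
  apply: inj; rewrite ?inE// hv hq; last by rewrite s0 lexx.
  by rewrite /r min_l ?max_l//; lra.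
- by rewrite s0.
- move=> t /andP[t0 te]; case: leP => ts; first by rewrite hq// t0.
  by rewrite (vP t).2 /r min_l// max_r// ltW.
Qed.

(** The supremum of the times reached by lifts is itself reached, by [lift_limit], and it equals 1,
    since a lift ending off [K] extends further. Allowing [g 1] in [K] is what lets edges be lifted
    up to their ends over 0 and 1. *)
Lemma lift_exists K h (g : R -> Y) (x : X) :
    hausdorff_space Y -> branched_cover K h -> continuous g ->
    (forall t, 0 <= t < 1 -> ~ K (g t)) -> h x = g 0 ->
  exists q : R -> X, [/\ continuous q, q 0 = x &
    forall t, 0 <= t <= 1 -> h (q t) = g t].
Proof.
move=> hY bch cg nK hx; have [hX cX ch lh iso] := bch.
pose L (s : R) (q : R -> X) := [/\ continuous q, q 0 = x &
  forall t, 0 <= t <= s -> h (q t) = g t].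
pose A := [set s : R | 0 <= s <= 1 /\ exists q, L s q].
have A0 : A 0.
  split; first by rewrite lexx ler01.
  exists (cst x); split=> // [|t]; first exact: cst_continuous.
  by rewrite -eq_le => /eqP <-.
have supA : has_sup A by split; [exists 0|exists 1 => t [/andP[]]].
pose s := sup A.
have s0 : 0 <= s by apply: ub_le_sup A0; exact: supA.2.
have s1 : s <= 1 by apply: ge_sup; [exists 0|move=> t [/andP[]]].
have A_lt t : 0 <= t < s -> exists q, L t q.
  move=> /andP[t0 ts].
  have [u [/andP[u0 u1] [q [cq q0 hq]]] tu] : exists2 u, A u & s - (s - t) < u.
    by apply: sup_adherent => //; rewrite subr_gt0.
  exists q; split=> // v /andP[v0 vt]; apply: hq; rewrite v0/=.
  by apply: le_trans vt _; lra.
have uniq u v q q' : L u q -> L v q' -> forall t, 0 <= t < 1 -> t <= u -> t <= v ->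
    q t = q' t.
  move=> [cq q0 hq] [cq' q'0 hq'] t /andP[t0 t1] tu tv.
  apply: (unique_lift bch (itv01 (s := t)) cq cq' _ _ (s := 0)).
  - move=> w; rewrite /= in_itv/= => /andP[w0 wt].
    by rewrite hq ?hq' ?w0/=//; [apply: le_trans wt _|apply: le_trans wt _].
  - move=> w; rewrite /= in_itv/= => /andP[w0 wt].
    rewrite hq; first by apply: nK; rewrite w0/=; exact: le_lt_trans wt t1.
    by rewrite w0/=; apply: le_trans wt _.
  - by rewrite /= in_itv/= lexx.
  - by rewrite /= in_itv/= lexx t0.
  - by rewrite q0.
have Ls : exists q, L s q.
  have [<-//|/eqP s_neq0] := pselect (0 = s); first exact: A0.2.
  have s_gt0 : 0 < s by rewrite lt_neqAle s_neq0.
  have /choice[Q QP] : forall t, exists q, 0 <= t < s -> L t q.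
    move=> t.
    have [/A_lt[q Lq]|nt] := pselect (0 <= t < s); first by exists q.
    by exists (cst x).
  (* The diagonal glues the chosen partial lifts: below any u < s it coincides with the single
     continuous lift [Q u]. *)
  pose W t := Q t t.
  have WQ t u : 0 <= t <= u -> u < s -> W t = Q u t.
    move=> /andP[t0 tu] us; apply: (uniq t u (Q t) (Q u)) => //.
    - by apply: QP; rewrite t0; exact: le_lt_trans us.
    - by apply: QP; rewrite us andbT; exact: le_trans tu.
    - by rewrite t0/=; apply: le_lt_trans tu _; exact: lt_le_trans us _.
  have hW t : 0 <= t < s -> h (W t) = g t.
    by move=> ts; have [_ _] := QP _ ts; apply; case/andP: ts => ->/=.
  have cW t : 0 < t < s -> {for t, continuous W}.
    move=> /andP[t0 ts]; pose u := (t + s) / 2.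
    have [tu us] : t < u /\ u < s by rewrite /u; split; lra.
    have [cQ _ _] : L u (Q u) by apply: QP; rewrite us andbT; lra.
    have WQn : \forall v \near t, Q u v = W v.
      near=> v; rewrite (WQ _ u)//; apply/andP; split; apply: ltW; near: v.
        exact: lt_nbhsr.
      exact: lt_nbhsl.
    rewrite /prop_for /continuous_at (WQ _ u)//; last by rewrite (ltW t0)/= ltW.
    by apply: cvg_trans (cQ t); apply: near_eq_cvg.
  have [y Wy hy] : exists2 y, W @ s^'- --> y & h y = g s.
    apply: (lift_limit hY bch s_gt0 cW _ (cg s)).
    by move=> t /andP[t0 ts]; rewrite hW// (ltW t0).
  (* The glued lift is made total by constants: x on the left, the limit y on the right. *)
  pose q t := if t <= 0 then x else if t < s then W t else y.
  exists q; split.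
  - move=> t.
    have [ts|ts|->] := ltgtP t s.
    + pose u := (Num.max 0 t + s) / 2.
      have m0 : 0 <= Num.max 0 t by rewrite le_max lexx.
      have mt : t <= Num.max 0 t by rewrite le_max lexx orbT.
      have ms : Num.max 0 t < s by rewrite gt_max s_gt0.
      have [tu us u0] : [/\ t < u, u < s & 0 <= u] by rewrite /u; split; lra.
      have Lu : L u (Q u) by apply: QP; rewrite us andbT.
      have [cQ Q0 _] := Lu.
      (* A continuous function that equals q on all of the half-line up to u, negative times
         included. *)
      pose Qm v := Q u (Num.max 0 v).
      have Qmq v : v <= u -> Qm v = q v.
        move=> vu; rewrite /Qm /q; case: (boolP (v <= 0)) => v0.
          by rewrite max_l.
        have {}v0 : 0 < v by rewrite ltNge.
        rewrite max_r ?(ltW v0)//.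
        by rewrite (le_lt_trans vu us) (WQ _ u)// vu ltW.
      rewrite /continuous_at -Qmq ?(ltW tu)//.
      have cQm : {for t, continuous Qm}.
        apply: (@continuous_o _ _ _ (fun v : R => Num.max 0 v) (Q u)) => // v.
        by apply: (@continuous_max R R (cst 0) id); [exact: cvg_cst|exact: cvg_id].
      apply: cvg_trans cQm; apply: near_eq_cvg.
      near=> v; apply: Qmq; apply: ltW; near: v; exact: lt_nbhsl.
    + have qy v : s < v -> q v = y.
        by move=> sv; rewrite /q leNgt (lt_trans s_gt0 sv)/= ltNge (ltW sv).
      rewrite /continuous_at qy//; apply: cvg_near_cst.
      by near=> v; apply: qy; near: v; exact: lt_nbhsr.
    + have qs : q s = y by rewrite /q leNgt s_gt0/= ltxx.
      rewrite /continuous_at qs => N Ny.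
      have := Wy N Ny; rewrite /= => WN.
      have {}WN : \forall v \near s, v < s -> N (W v) by [].
      have s0n : \forall v \near s, 0 < v by exact: lt_nbhsr.
      apply: filterS (filterI WN s0n) => v [vN v0] /=.
      rewrite /q leNgt v0/=; case: ltP => // _; exact: nbhs_singleton.
  - by rewrite /q lexx.
  - move=> t /andP[t0 ts]; rewrite /q.
    have [t0'|t0'] := leP t 0.
      by have -> : t = 0 by apply/eqP; rewrite eq_le t0 t0'.
    have [ts'|st] := ltP t s; first by rewrite hW// t0.
    by have -> : t = s by apply/eqP; rewrite eq_le st ts.
have [s_lt1|s_ge1] := ltP s 1; last first.
  have s1E : s = 1 by apply/eqP; rewrite eq_le s1 s_ge1.
  by move: Ls; rewrite s1E.
have [q [cq q0 hq]] := Ls.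
have hqs : h (q s) = g s by rewrite hq// s0 lexx.
have lhs : local_homeomorphism_at h (q s).
  by apply: lh; rewrite hqs; apply: nK; rewrite s0.
have [e e0 [q' [cq' q'0 hq']]] := lift_extend s0 cg cq hq lhs.
(* The extension reaches t > s, against the choice of s as a supremum. *)
pose t := Num.min 1 (s + e).
have /(ub_le_sup supA.2) : A t.
  split; first by rewrite le_min ler01 ge_min lexx/= andbT; lra.
  exists q'; split=> //; first by rewrite q'0.
  move=> u /andP[u0 ut]; apply: hq'; rewrite u0/=; apply: le_trans ut _.
  by rewrite ge_min lexx orbT.
by rewrite -/s /t ge_min leNgt s_lt1/= gerDl leNgt e0.
Unshelve. all: by end_near. Qed.

(* By a local section of h at Q t0 s, continuity of t |-> Q t s at t0 is locally
   constant in s. *)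
Lemma lift_endpoint_continuous K h (T : topologicalType) (H : T -> R -> Y)
    (Q : T -> R -> X) (t0 : T) :
    branched_cover K h ->
    continuous (fun ts : T * R => H ts.1 ts.2) ->
    (forall t, continuous (Q t)) ->
    (forall t s, 0 <= s <= 1 -> h (Q t s) = H t s) ->
    (forall t s, 0 <= s <= 1 -> ~ K (H t s)) ->
    {for t0, continuous (Q^~ 0)} ->
  {for t0, continuous (Q^~ 1)}.
Proof.
move=> bch cH cQ hQ nK c0; have [hX cX ch lh iso] := bch.
apply: (@connected_ind _ [set` `[0 : R, 1]]
  (fun s => {for t0, continuous (Q^~ s)}) (itv01 (s := 1)) _ 0 1) => //.
- move=> s'; have {s'}[s ->] : exists s : R, s' = s by exists s'.
  rewrite /= in_itv/= => s01.
  have [U [oU Us inj op]] : local_homeomorphism_at h (Q t0 s).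
    by apply: lh; rewrite hQ//; exact: nK.
  have : nbhs (t0, s) ((fun ts : T * R => H ts.1 ts.2) @^-1` (h @` U)).
    apply: cH => /=; apply: open_nbhs_nbhs; split; first exact: op.
    by exists (Q t0 s) => //; rewrite hQ.
  move=> [[/= V B] [Vt Bs] VB].
  have QU : nbhs s (Q t0 @^-1` U) by apply: cQ; exact: open_nbhs_nbhs.
  have : nbhs s (B `&` Q t0 @^-1` U) by exact: filterI.
  move=> /nbhs_ballP[e /= e0 eP].
  exists (ball s e); first exact: nbhsx_ballx.
  move=> s1 s2 s1e s2e; rewrite /= !in_itv/= => s101 s201 c1.
  (* Over this interval, for t in [V], the values of [H t] lie in the image of [U]. A lift [Q t]
     that is in [U] at one time of the interval must be shown to remain there. *)
  pose D := [set` `[0 : R, 1]] `&` ball s e.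
  have cD : connected D.
    apply/connected_intervalP => a b; rewrite /D/= !in_itv/= /ball/=.
    move=> [/andP[a0 a1]]; rewrite ltr_norml => /andP[a2 a3].
    move=> [/andP[b0 b1]]; rewrite ltr_norml => /andP[b2 b3] u /andP[au ub].
    split; first by rewrite in_itv/=; apply/andP; split; lra.
    by rewrite ltr_norml; apply/andP; split; lra.
  have Ds1 : D s1 by split; rewrite //= in_itv.
  have Ds2 : D s2 by split; rewrite //= in_itv.
  have QU' : \forall t \near t0, U (Q t s2).
    have QUs1 : \forall t \near t0, U (Q t s1).
      by apply: c1; apply: open_nbhs_nbhs; split=> //; exact: (eP _ s1e).2.
    apply: filterS (filterI Vt QUs1) => t [Vt' Ut].
    apply: (@connected_ind _ D (fun u => U (Q t u)) cD _ s1 s2) => // u Du.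
    have [Uu|nUu] := pselect (U (Q t u)).
      by exists (Q t @^-1` U) => //; apply: cQ; exact: open_nbhs_nbhs.
    have u01 : 0 <= u <= 1 by case: Du; rewrite /= in_itv.
    have [w Uw hw] := VB (t, u) (conj Vt' (eP _ Du.2).1).
    (* Being outside [U] is also an open condition in u: the point of [U] over [H t v] stays near w,
       away from [Q t v], so by injectivity on [U] the latter is not in [U]. *)
    have /eqP : w <> Q t u by move=> wE; apply: nUu; rewrite -wE.
    move: (hX); rewrite open_hausdorff => sep /sep[[A B'] /=].
    move=> [/set_mem Aw /set_mem B'Q] [oA oB' /eqP AB0].
    have cHt : {for u, continuous (H t)}.
      apply: (@continuous_o _ _ _ (fun u => (t, u)) (fun ts => H ts.1 ts.2)) => //.
      by apply: continuous_pair => ?; [exact: cvg_cst|exact: cvg_id].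
    have HA : nbhs u (H t @^-1` (h @` (U `&` A))).
      apply: cHt; apply: open_nbhs_nbhs; split; last by exists w.
      by apply: op; [exact: openI|move=> ? []].
    have QB' : nbhs u (Q t @^-1` B') by apply: cQ; exact: open_nbhs_nbhs.
    exists (H t @^-1` (h @` (U `&` A)) `&` Q t @^-1` B'); first exact: filterI.
    move=> v ? [[w' [Uw' Aw'] hw'] B'v] _ [v01 _] _ Uv; exfalso.
    have : (A `&` B') w'; last by rewrite AB0.
    split=> //; suff -> : w' = Q t v by [].
    by apply: inj; rewrite ?inE// hw' hQ//; move: v01; rewrite /= in_itv.
  move=> N /=; rewrite nbhsE => -[N' [oN' N't] N'N].
  have cHs : {for t0, continuous (H^~ s2)}.
    apply: (@continuous_o _ _ _ (fun t => (t, s2)) (fun ts => H ts.1 ts.2)) => //.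
    by apply: continuous_pair => ?; [exact: cvg_id|exact: cvg_cst].
  have HN' : nbhs t0 (H^~ s2 @^-1` (h @` (U `&` N'))).
    apply: cHs; apply: open_nbhs_nbhs; split.
      by apply: op; [exact: openI|move=> ? []].
    exists (Q t0 s2); last exact: hQ.
    by split=> //; exact: (eP _ s2e).2.
  change (nbhs t0 ((Q^~ s2) @^-1` N)).
  apply: filterS (filterI QU' HN') => t [UQ [w [Uw N'w] hw]].
  by apply: N'N; suff <- : w = Q t s2 by []; apply: inj; rewrite ?inE// hw hQ.
- by rewrite /= in_itv/= lexx ler01.
- by rewrite /= in_itv/= lexx ler01.
Qed.

End branched_cover.

(** * Zeros of power series *)

Section complex_plane.
Variable R : realType.
Local Notation C := (C R).

(** The terms beyond index k are dominated by a geometric series of ratio at most 1/2; the factor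
    [2 - 2 / 2 ^+ j] is the sum of its first j powers of 1/2. *)
Lemma power_series_remainder (c : nat -> C) (k : nat) (rho M u : C) :
    0 < rho -> (0 < k)%N -> `|u| <= rho / 2 ->
    (forall n, (0 < n)%N -> `|c n| * rho ^+ n <= M) ->
    (forall n, (0 < n < k)%N -> c n = 0) ->
  forall j, `|series (fun n => c n * u ^+ n) (k.+1 + j)%N - (c 0%N + c k * u ^+ k)|
    <= M * (`|u| / rho) ^+ k.+1 * (2 - 2 / 2 ^+ j).
Proof.
move=> rho0 k0 ur cM ck.
have rhoN0 : rho != 0 by rewrite gt_eqF.
have M0 : 0 <= M.
  by apply: le_trans (cM 1%N isT); rewrite mulr_ge0// exprn_ge0// ltW.
have x0 : 0 <= `|u| / rho by rewrite divr_ge0// ltW.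
have x2 : `|u| / rho <= 2^-1 by rewrite ler_pdivrMr// mulrC.
elim=> [|j IH].
  rewrite addn0 expr0 divr1 subrr mulr0 /series/= big_nat_recr//=.
  case: k k0 ck {x0 x2} => // k _ ck.
  rewrite big_nat_recl//= expr0 mulr1 big1_seq ?addr0 ?subrr ?normr0//.
  move=> i /andP[_]; rewrite mem_index_iota => /andP[_ ik].
  by rewrite ck ?mul0r.
rewrite addnS seriesSr/= addrAC (le_trans (ler_normD _ _))//.
rewrite (le_trans (lerD IH (_ : _ <= M * (`|u| / rho) ^+ k.+1 * 2^-1 ^+ j)))//.
  rewrite normrM normrX.
  have -> : `|c (k.+1 + j)%N| * `|u| ^+ (k.+1 + j) =
      (`|c (k.+1 + j)%N| * rho ^+ (k.+1 + j)) * (`|u| / rho) ^+ (k.+1 + j).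
    by rewrite expr_div_n -mulrA; congr (_ * _); rewrite mulrC divfK// expf_neq0.
  rewrite [(_ / _) ^+ _]exprD mulrA ler_pM//.
  - by rewrite !mulr_ge0// exprn_ge0// ltW.
  - by rewrite exprn_ge0.
  - by rewrite ler_wpM2r ?exprn_ge0// cM.
  - by rewrite lerXn2r// nnegrE// invr_ge0.
rewrite -mulrDr ler_wpM2l ?mulr_ge0 ?exprn_ge0//.
rewrite exprVn exprS invfM mulrA divff ?mul1r// ?pnatr_eq0//.
suff -> : 2 - 2 / 2 ^+ j + 2 ^- j = 2 - 2 ^- j :> C by [].
ring.
Qed.

Lemma power_series_bound (c : nat -> C) (u l : C) :
    series (fun n => c n * u ^+ n) @ \oo --> l ->
  exists M, forall n, `|c n| * `|u| ^+ n <= M.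
Proof.
move=> sl; have bdd : bounded_fun (fun n => c n * u ^+ n).
  apply: (@cvg_seq_bounded C C); apply: cvgP; apply: (@cvg_series_cvg_0 C C).
  by apply/cvg_ex; exists l.
have PF : ProperFilter (globally [set: nat]).
  by apply: globally_properfilter; exact: (I : setT 0%N).
have /(@ex_bound _ _ _ _ _ PF)[M MP] := bdd.
by exists M => n; have := MP n I; rewrite /= normrM normrX.
Qed.


(** If k is the least positive index with [c k] nonzero, the term [c k * (w - z) ^+ k] dominates the
    remainder near z, so f takes the value [f z] only at z. If there is no such k, f is constant
    near z. *)
Lemma holomorphic_isolated (f : C -> C) (z : C) : holomorphic_at f z ->
  (\forall w \near z, f w = f z) \/ (\forall w \near z, f w = f z -> w = z).
Proof.
move=> [c [r [r0 fE]]].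
pose rho := r / 2; have rho0 : 0 < rho by rewrite divr_gt0.
have rho_lt : rho < r by rewrite ltr_pdivrMr// mulr_natr mulr2n ltrDl.
have [M0 M0P] : exists M, forall n, `|c n| * rho ^+ n <= M.
  have := fE (z + rho); rewrite addrC addKr (gtr0_norm rho0) => /(_ rho_lt).
  by move=> /power_series_bound; rewrite (gtr0_norm rho0).
have le2 : rho / 2 < r.
  apply: le_lt_trans rho_lt; rewrite ler_pdivrMr// mulr_natr mulr2n lerDl.
  exact: ltW.
have bound k M : (0 < k)%N -> (forall n, (0 < n)%N -> `|c n| * rho ^+ n <= M) ->
    (forall n, (0 < n < k)%N -> c n = 0) -> forall w, `|w - z| <= rho / 2 ->
    `|f w - (c 0%N + c k * (w - z) ^+ k)| <= M * (`|w - z| / rho) ^+ k.+1 * 2.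
  move=> k0 MP ck w wz.
  have M0' : 0 <= M.
    by apply: le_trans (MP 1%N isT); rewrite mulr_ge0// exprn_ge0// ltW.
  have B0 : 0 <= M * (`|w - z| / rho) ^+ k.+1.
    by rewrite mulr_ge0// exprn_ge0// divr_ge0// ltW.
  (* The estimate passes to the limit by contradiction: a positive excess would exceed the distance
     from [f w] to some late partial sum. The order of C being partial, both sides must be known to
     be real. *)
  rewrite real_leNgt ?normr_real// ?ger0_real//; last by rewrite mulr_ge0.
  apply/negP => lt_f.
  have := fE w (le_lt_trans wz le2) => /(@cvgrPdist_lt C C).
  rewrite -subr_gt0 in lt_f => /(_ _ lt_f)[N _ /(_ (k.+1 + N)%N)].
  move=> /(_ (leq_addl _ _)).
  rewrite /= real_ltNge ?normr_real ?gtr0_real// => /negP; apply.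
  have := power_series_remainder rho0 k0 wz MP ck N.
  set S := series _ _ => Sle; rewrite lerBlDr.
  apply: le_trans (ler_distD S _ _) _; rewrite lerD2l (le_trans Sle)//.
  by rewrite ler_wpM2l// lerBlDr lerDl divr_ge0// exprn_ge0.
have fz : f z = c 0%N.
  have := fE z; rewrite subrr normr0 => /(_ r0) cz.
  apply: (cvg_unique (@norm_hausdorff C C) cz); apply: cvg_near_cst.
  exists 1%N => // -[//|n] _ /=.
  rewrite /series/= big_nat_recl// expr0 mulr1 big1 ?addr0// => i _.
  by rewrite exprS mul0r mulr0.
have near_z d : 0 < d -> \forall w \near z, `|w - z| < d.
  move=> d0; have := nbhsx_ballx z d d0.
  by apply: filterS => w; rewrite /ball/= distrC.
have [cE|/existsNP[k0 /not_implyP[k00 /eqP ck0]]] :=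
    pselect (forall n, (0 < n)%N -> c n = 0).
  (* With all higher coefficients zero, the bound is used with k = 1 and M = 0. *)
  left; near=> w; rewrite fz; apply/eqP; rewrite -subr_eq0 -normr_le0.
  have := bound 1%N 0 isT _ _ w.
  rewrite (cE 1%N)// !mul0r addr0; apply.
  - by move=> n n0; rewrite cE// normr0 mul0r.
  - by move=> n; case: n => [|[]].
  - by apply: ltW; near: w; apply: near_z; rewrite divr_gt0.
have exk : exists k, (0 < k)%N && (c k != 0) by exists k0; rewrite k00.
pose k := ex_minn exk.
have [kP kmin] : (0 < k)%N && (c k != 0) /\
    forall n, (0 < n)%N && (c n != 0) -> (k <= n)%N.
  by rewrite /k; case: ex_minnP.
case/andP: kP => k_gt0 ck.
have c0k n : (0 < n < k)%N -> c n = 0.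
  move=> /andP[n0 nk]; apply/eqP; apply: contraTT nk => cn; rewrite -leqNgt.
  by apply: kmin; rewrite n0.
have M00 : 0 <= M0 by apply: le_trans (M0P 0%N); rewrite mulr_ge0// exprn_ge0.
have B0 : 0 < 2 * M0 + 1 by rewrite ltr_wpDl// mulr_ge0.
have ck_gt0 : 0 < `|c k| * rho ^+ k.+1 by rewrite mulr_gt0 ?normr_gt0 ?exprn_gt0.
right; near=> w => fw; apply/eqP; rewrite -subr_eq0; apply: contraT => u0.
have := bound k M0 k_gt0 (fun n _ => M0P n) c0k w.
rewrite fw fz opprD addNKr normrN normrM normrX.
have -> : `|w - z| <= rho / 2.
  by apply: ltW; near: w; apply: near_z; rewrite divr_gt0.
move=> /(_ isT).
have -> : M0 * (`|w - z| / rho) ^+ k.+1 * 2 =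
    (2 * M0 * `|w - z| / rho ^+ k.+1) * `|w - z| ^+ k.
  by rewrite expr_div_n exprS; ring.
rewrite ler_pM2r ?exprn_gt0 ?normr_gt0// ler_pdivlMr ?exprn_gt0// => ck_le.
(* The inequality [ck_le] forces w to be at least at distance [|c k| * rho ^+ k.+1 / (2 * M0)] from
   z when [M0] is positive; the added 1 keeps the denominator positive when [M0] is 0. *)
have : `|w - z| < `|c k| * rho ^+ k.+1 / (2 * M0 + 1).
  by near: w; apply: near_z; exact: divr_gt0.
rewrite ltr_pdivlMr// => lt_ck; have := lt_le_trans lt_ck ck_le.
by rewrite mulrDr mulr1 mulrC gtrDl normr_lt0.
Unshelve. all: by end_near. Qed.

End complex_plane.

(** * The Riemann sphere and Belyi maps *)

Section sphere_topology.
Variable R : realType.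
Local Notation C := (C R).
Local Notation P1 := (P1 R).

Lemma Re_continuous : continuous (fun z : C => complex.Re z).
Proof.
move=> z; apply/(@cvgrPdist_lt R R C (nbhs z) (nbhs_filter z)) => e e0.
have e0' : 0 < Complex e 0 :> C by rewrite ltcE/= eqxx.
have zb : nbhs z (ball z (Complex e 0 : C)) by exact: nbhsx_ballx.
change (nbhs z (fun w : C => `|complex.Re z - complex.Re w| < e)).
apply: filterS zb => w /= zw.
have := le_lt_trans (normc_ge_Re (z - w)) zw.
by rewrite ltcE/= eqxx/=; case: (z) (w) => [? ?] [? ?].
Qed.

Lemma normc_ge_Im (z : C) : (`|complex.Im z|%:C)%C <= `|z|.
Proof.
by have := normc_ge_Re (z * 'i%C); rewrite normrM normCi mulr1 ReiNIm normrN.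
Qed.

Lemma Im_continuous : continuous (fun z : C => complex.Im z).
Proof.
move=> z; apply/(@cvgrPdist_lt R R C (nbhs z) (nbhs_filter z)) => e e0.
have e0' : 0 < Complex e 0 :> C by rewrite ltcE/= eqxx.
have zb : nbhs z (ball z (Complex e 0 : C)) by exact: nbhsx_ballx.
change (nbhs z (fun w : C => `|complex.Im z - complex.Im w| < e)).
apply: filterS zb => w /= zw.
have := le_lt_trans (normc_ge_Im (z - w)) zw; rewrite ltcE/= eqxx/=.
by case: (z) (w) => [? ?] [? ?].
Qed.

(** Squares, rather than discs, as exhausting compact sets: their compactness comes from that of a
    product of two real segments. *)
Definition box (M : R) : set C :=
  [set z | `|complex.Re z| <= M /\ `|complex.Im z| <= M].

Lemma box_compact M : compact (box M).
Proof.
have -> : box M = (fun p : R * R => Complex p.1 p.2 : C) @`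
    ([set` `[- M, M]] `*` [set` `[- M, M]]).
  apply/seteqP; split=> [[a b] /= [aM bM]|_ [[a b] /= [aM bM] <-]].
    by exists (a, b) => //=; rewrite !in_itv/= -!ler_norml.
  by move: aM bM; rewrite /box/= !in_itv/= -!ler_norml.
apply: continuous_compact; last by apply: compact_setX; exact: segment_compact.
apply: continuous_subspaceT; apply: continuous_Complex.
  by move=> ?; exact: cvg_fst.
by move=> ?; exact: cvg_snd.
Qed.

Lemma box_closed M : closed (box M).
Proof.
by apply: compact_closed; [exact: (@norm_hausdorff C C)|exact: box_compact].
Qed.

Lemma C_locally_compact : locally_compact [set: C].
Proof.
move=> z _; pose M := `|complex.Re z| + `|complex.Im z| + 1.
exists (box M); last by split; [exact: box_compact|exact: box_closed].
rewrite withinET.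
have nRe : nbhs z ((fun z : C => complex.Re z) @^-1` [set x | `|x| < M]).
  apply: Re_continuous.
  apply: (@norm_continuous R R (complex.Re z) [set y | y < M]); apply: lt_nbhsl.
  by rewrite /M -addrA ltrDl ltr_wpDl.
have nIm : nbhs z ((fun z : C => complex.Im z) @^-1` [set x | `|x| < M]).
  apply: Im_continuous.
  apply: (@norm_continuous R R (complex.Im z) [set y | y < M]); apply: lt_nbhsl.
  by rewrite /M addrAC ltrDr ltr_wpDl.
by apply: filterS (filterI nRe nIm) => w [/= ? ?]; split; exact: ltW.
Qed.

Lemma P1_hausdorff : hausdorff_space P1.
Proof.
apply: one_point_compactification_hausdorff; first exact: C_locally_compact.
exact: (@norm_hausdorff C C).
Qed.

Lemma P1_compact : compact [set: P1].
Proof. exact: one_point_compactification_compact. Qed.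

Lemma continuous_fin : continuous (@fin R).
Proof. exact: one_point_compactification_some_continuous. Qed.

(** The plane is a union of real lines through 0, and it is dense in the sphere because it is not
    compact. *)
Lemma P1_connected : connected [set: P1].
Proof.
have cR : connected [set: R] by apply/connected_intervalP.
have cC : connected [set: C].
  have -> : [set: C] =
      \bigcup_(w in [set: C]) ((fun t : R => Complex t 0 * w) @` [set: R]).
    apply/seteqP; split=> // w _; exists w => //; exists 1 => //.
    exact: mul1r.
  apply: bigcup_connected.
    exists 0 => w _; exists 0 => //; exact: mul0r.
  move=> w _; apply: connected_continuous_connected => //.
  apply: continuous_subspaceT => t; apply: (@cvgM C R); last exact: cvg_cst.
  by apply: continuous_Complex => ?; [exact: cvg_id|exact: cvg_cst].
have <- : closure (@fin R @` [set: C]) = [set: P1].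
  apply/seteqP; split=> // -[z|] _; first by apply: subset_closure; exists z.
  move=> B [K [cK clK] KB].
  have [w nKw] : exists w, ~ K w.
    apply: contrapT => /forallNP KT.
    have {KT}KT : K = setT by apply/seteqP; split=> // w _; exact: contrapT (KT w).
    have /compact_has_sup : compact ((fun z : C => complex.Re z) @` K).
      apply: continuous_compact => //; apply: continuous_subspaceT.
      exact: Re_continuous.
    case; first by exists 0, 0; rewrite ?KT.
    move=> _ [M /(_ (M + 1))]; rewrite gerDl leNgt ltr01; apply/not_implyP.
    by split => //; exists (Complex (M + 1) 0) => //; rewrite KT.
  by exists (fin w); split; [exists w|apply: KB; left; exists w].
apply: connected_closure; apply: connected_continuous_connected => //.
by apply: continuous_subspaceT; exact: continuous_fin.
Qed.

(** A weakening of [is_chart] shared by the charts of X and the two standard charts of the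
    sphere. *)
Definition coordinate (X : topologicalType) (a : chart R X) : Prop :=
  [/\ open (cdom a), forall x, cdom a x -> cinv a (cfun a x) = x &
      forall x, cdom a x -> {for x, continuous (cfun a)}].

Lemma P1_open_neq (z : P1) : open [set w | w <> z].
Proof.
have -> : [set w | w <> z] = ~` [set z] by [].
apply: closed_openC; apply: accessible_closed_set1.
by apply: hausdorff_accessible; exact: P1_hausdorff.
Qed.

Lemma P1_coordinate a : @P1_atlas R a -> coordinate a.
Proof.
move=> [->|->]; split => /=.
- exact: P1_open_neq.
- by case.
- by case=> // w _; exact: cvg_id.
- exact: P1_open_neq.
- move=> [w|_]; last by rewrite eqxx.
  move=> w0; rewrite invr_eq0; case: eqP => [w0'|_]; last by rewrite invrK.
  by rewrite w0' in w0.
- move=> [w|] w0.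
    have wN0 : w != 0 by apply/eqP => w0'; rewrite w0' in w0.
    have : {for w, continuous (@GRing.inv C)} by exact: inv_continuous.
    by [].
  apply/(@cvgrPdist_lt C C _ (nbhs (infty : P1)) (nbhs_filter _)) => e e0.
  (* Outside the square of half-side 1/e a point has modulus above 1/e, hence an inverse of modulus
     below e. *)
  pose M := (complex.Re e)^-1.
  have e_gt0 : 0 < complex.Re e by move: e0; rewrite ltcE => /andP[].
  have eE : e = (complex.Re e)%:C%C.
    by move: e0; rewrite ltcE => /andP[/eqP + _]; case: (e) => ? ? /= ->.
  exists (box M); first by split; [exact: box_compact|exact: box_closed].
  move=> _ [[w nbw <-]|->] /=; last by rewrite subrr normr0.
  rewrite sub0r normrN normfV.
  have Me : e^-1 = M%:C%C by rewrite {1}eE -fmorphV.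
  have Mw : e^-1 < `|w|.
    rewrite Me; move: nbw => /not_andP[]/negP; rewrite -ltNge => Mw.
      apply: lt_le_trans (normc_ge_Re w); by rewrite ltcR.
    by apply: lt_le_trans (normc_ge_Im w); rewrite ltcR.
  have e'0 : 0 < e^-1 by rewrite invr_gt0.
  by rewrite -[ltRHS]invrK ltf_pV2 // posrE (lt_trans e'0).
Qed.

Lemma isolated_of_holomorphic (X : topologicalType) (a : chart R X)
    (b : chart R P1) (h : X -> P1) (x : X) :
    coordinate a -> coordinate b -> cdom a x -> cdom b (h x) ->
    {for x, continuous h} ->
    holomorphic_at (cfun b \o h \o cinv a) (cfun a x) ->
  (\forall x' \near x, h x' = h x) \/ (\forall x' \near x, h x' = h x -> x' = x).
Proof.
move=> [oa aK ca] [ob bK cb] ax bx ch hol.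
have na : nbhs x (cdom a) by exact: open_nbhs_nbhs.
have nb : nbhs x (h @^-1` cdom b) by apply: ch; exact: open_nbhs_nbhs.
case: (holomorphic_isolated hol) => /(ca x ax) fP; [left|right].
  apply: filterS (filterI (fP : nbhs x (cfun a @^-1` _)) (filterI na nb))
  => x' /= [+ [ax' bx']].
  by rewrite !aK// => hE; rewrite -(bK _ bx') hE bK.
apply: filterS (filterI (fP : nbhs x (cfun a @^-1` _)) (filterI na nb))
  => x' /= [+ [ax' bx']].
by rewrite !aK// => hE hx'; rewrite -(aK _ ax') hE ?aK// hx'.
Qed.

(** Only the isolation of fibers requires an argument: were h constant near one point, the locus
    where it is locally equal to that constant would be open and closed, and h would be constant. *)
Lemma belyi_branched_cover (X : topologicalType) (A : set (chart R X))
    (h : X -> P1) :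
    hausdorff_space X -> connected [set: X] -> compact [set: X] ->
    (forall a, A a -> coordinate a) -> (forall x, exists2 a, A a & cdom a x) ->
    belyi A h ->
  branched_cover cusps h.
Proof.
move=> hX conX cX Acoord Acov [[ch hol] [x0 [y0 hxy]] lh].
split => // x.
have dich y : (\forall x' \near y, h x' = h y) \/
    (\forall x' \near y, h x' = h y -> x' = y).
  have [a Aa ay] := Acov y.
  have [b Bb bhy] : exists2 b, @P1_atlas R b & cdom b (h y).
    case: (h y) => [w|]; first by exists (@finite_chart R) => //; left.
    by exists (@infinite_chart R) => //; right.
  apply: (isolated_of_holomorphic (Acoord a Aa) (P1_coordinate Bb) ay bhy (ch y)).
  exact: hol.
case: (dich x) => // hx; exfalso; apply: hxy.
suff hE y : h y = h x by rewrite !hE.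
suff : \forall x' \near y, h x' = h x by move=> /nbhs_singleton.
apply: (@connected_ind _ setT
  (fun y => \forall x' \near y, h x' = h x) conX _ x y) => // u _.
have [hu|hu] := pselect (h u = h x); last first.
  exists [set v | h v <> h x].
    have : nbhs u (h @^-1` [set z | z <> h x]).
      by apply: ch; apply: open_nbhs_nbhs; split=> //; exact: P1_open_neq.
    by [].
  by move=> v ? nv _ _ _ /nbhs_singleton.
have [Pu|nPu] := pselect (\forall x' \near u, h x' = h x).
  exists (interior [set v | h v = h x]) => //.
  by apply: open_nbhs_nbhs; split => //; exact: open_interior.
case: (dich u); rewrite hu => hu'; first by [].
(* Here u is isolated in its fiber, so a nearby point where h is locally equal to [h x] could only
   be u itself. *)
exists [set v | h v = h x -> v = u] => // v w vu _ _ _ Pv; exfalso; apply: nPu.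
by rewrite -(vu (nbhs_singleton Pv)).
Qed.

(** Since [beta] preserves the cusps, a point not over a cusp for the composition is not over one
    for [gamma] either, so both maps are local homeomorphisms where needed. *)
Lemma branched_cover_comp (X : topologicalType) (beta : P1 -> P1) (gamma : X -> P1) :
    branched_cover cusps beta -> branched_cover cusps gamma ->
    beta @` cusps `<=` cusps ->
  branched_cover cusps (beta \o gamma).
Proof.
move=> [_ _ cb lb ib] [hX cX cg lg ig] bcusps.
split => //; first exact: continuous_o.
- move=> x /= nbx.
  have [V [oV Vx injV opV]] := lb _ nbx.
  have ngx : ~ cusps (gamma x).
    by move=> gx; apply: nbx; apply: bcusps; exists (gamma x).
  have [U [oU Ux injU opU]] := lg _ ngx.
  exists (U `&` gamma @^-1` V); split.
  + by apply: openI => //; move/continuousP: cg; apply.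
  + by [].
  + move=> u v /set_mem[Uu Vu] /set_mem[Uv Vv] /= e.
    by apply: injU; rewrite ?inE//; apply: injV; rewrite ?inE.
  + move=> W oW WU; rewrite -image_comp; apply: opV.
      by apply: opU => // w /WU[].
    by move=> _ [w /WU[_ Vw] <-].
- move=> x; apply: filterS (filterI (ig x) (cg x _ (ib (gamma x)))) => x' /= [gE bE].
  by move=> e; apply: gE; exact: bE.
Qed.

End sphere_topology.

(** * Edges and monodromy *)

Section lifting.
Variables (R : realType) (X : topologicalType) (h : X -> P1 R).
Hypothesis bch : branched_cover cusps h.
Local Notation I := (I01 R).
Local Notation Pstar := (Pstar R).

(** Transport of fibers along p as a relation, functional and injective by unique lifting. Taking p
    as a plain function avoids endpoint types when paths are concatenated or reversed. *)
Definition lifts_to (p : I -> Pstar) (x y : X) : Prop :=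
  exists q : I -> X, [/\ is_lift h p q, q zero = x & q one = y].

Lemma val_Pstar_continuous : continuous (fun z : Pstar => set_val z : P1 R).
Proof. exact: initial_continuous. Qed.

Lemma Pstar_ncusp (z : Pstar) : ~ cusps (set_val z : P1 R).
Proof. exact: set_valP z. Qed.

Lemma Pstar_inj (z w : Pstar) : set_val z = set_val w :> P1 R -> z = w.
Proof. exact: val_inj. Qed.

Lemma I_connected : connected [set: I].
Proof.
have -> : [set: I] = clamp @` [set: R].
  by apply/seteqP; split=> // t _; exists (rv t) => //; exact: rvK.
apply: connected_continuous_connected; first by apply/connected_intervalP.
by apply: continuous_subspaceT; exact: clamp_continuous.
Qed.

Lemma is_lift_uniq (p : I -> Pstar) (q q' : I -> X) (s : I) :
  is_lift h p q -> is_lift h p q' -> q s = q' s -> q =1 q'.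
Proof.
move=> [cq hq] [cq' hq'] qs t.
apply: (unique_lift bch I_connected cq cq' _ _ (s := s)) => // u _.
  by rewrite hq hq'.
by rewrite hq; exact: Pstar_ncusp.
Qed.

Lemma lifts_to_uniq p x y y' : lifts_to p x y -> lifts_to p x y' -> y = y'.
Proof.
move=> [q [lq q0 <-]] [q' [lq' q'0 <-]].
by apply: (is_lift_uniq (s := zero) lq lq'); rewrite q0.
Qed.

Lemma lifts_to_inj p x x' y : lifts_to p x y -> lifts_to p x' y -> x = x'.
Proof.
move=> [q [lq <- q1]] [q' [lq' <- q'1]].
by apply: (is_lift_uniq (s := one) lq lq'); rewrite q1.
Qed.

Lemma lifts_to_over p x y : lifts_to p x y ->
  h x = set_val (p zero) /\ h y = set_val (p one).
Proof. by move=> [q [[_ hq] <- <-]]; rewrite !hq. Qed.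

Lemma lifts_to_flip p x y : lifts_to p x y -> lifts_to (p \o flip) y x.
Proof.
move=> [q [[cq hq] q0 q1]]; exists (q \o flip); split => /=.
- split => [|t]; last exact: hq.
  by apply: continuous_o; [exact: flip_continuous|exact: cq].
- by rewrite flip0.
- by rewrite flip1.
Qed.

Lemma lifts_to_concat p p' x y z :
  lifts_to p x y -> lifts_to p' y z -> lifts_to (concat_fun p p') x z.
Proof.
move=> [q [[cq hq] q0 q1]] [q' [[cq' hq'] q'0 q'1]].
exists (concat_fun q q'); split; rewrite ?concat_fun0 ?concat_fun1//.
split; first by apply: concat_fun_continuous; rewrite ?q1.
by move=> t; rewrite /concat_fun; case: ifP.
Qed.

Lemma lifts_to_exists (p : I -> Pstar) x : continuous p ->
  h x = set_val (p zero) -> exists y, lifts_to p x y.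
Proof.
move=> cp hx.
have cg : continuous (fun t : R => set_val (p (clamp t)) : P1 R).
  apply: (@continuous_o _ _ _ (p \o clamp) (fun z : Pstar => set_val z : P1 R)).
    by apply: continuous_o; [exact: clamp_continuous|].
  exact: val_Pstar_continuous.
have [||q [cq q0 hq]] := lift_exists (x := x) (@P1_hausdorff R) bch cg.
- by move=> t _; exact: Pstar_ncusp.
- exact: hx.
exists (q 1); exists (q \o rv); split => /=; rewrite ?rv0 ?rv1//.
split; first by apply: continuous_o; [exact: rv_continuous|].
by move=> t; rewrite hq ?rvP// rvK.
Qed.

(* The end of the lift moves continuously in a discrete fiber. *)
Lemma lifts_to_family (F : I * I -> Pstar) (x_ : I -> X) (y : X) :
    continuous F -> continuous x_ ->
    (forall s, h (x_ s) = set_val (F (s, zero))) ->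
    (forall s, F (s, one) = F (zero, one)) ->
    lifts_to (fun t => F (zero, t)) (x_ zero) y ->
  lifts_to (fun t => F (one, t)) (x_ one) y.
Proof.
move=> cF cx hx F1 ly.
have cFs s : continuous (fun t => F (s, t)).
  apply: (@continuous_o _ _ _ (fun t => (s, t)) F) => //.
  by apply: continuous_pair; [exact: cst_continuous|move=> ?; exact: cvg_id].
have cG : continuous (fun st : I * R => set_val (F (st.1, clamp st.2)) : P1 R).
  apply: (@continuous_o _ _ _ (fun st : I * R => F (st.1, clamp st.2))
    (fun z : Pstar => set_val z : P1 R)); last exact: val_Pstar_continuous.
  apply: (@continuous_o _ _ _ (fun st : I * R => (st.1, clamp st.2)) F) => //.
  apply: continuous_pair; first by move=> ?; exact: cvg_fst.
  apply: (@continuous_o _ _ _ snd clamp); last exact: clamp_continuous.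
  by move=> ?; exact: cvg_snd.
have /choice[q qP] : forall s, exists q,
    is_lift h (fun t => F (s, t)) q /\ q zero = x_ s.
  by move=> s; have [y' [q [lq q0 _]]] := lifts_to_exists (cFs s) (hx s); exists q.
have cq1 : continuous (fun s => q s one).
  have clamp1 : clamp 1 = one :> I by [].
  move=> s; rewrite -clamp1.
  apply: (@lift_endpoint_continuous _ _ _ _ _ _ (fun s t => set_val (F (s, clamp t)))
    (fun s => q s \o clamp) s bch cG).
  - move=> t; apply: continuous_o; first exact: clamp_continuous.
    by have [[]] := qP t.
  - by move=> t u _; have [[_ ->]] := qP t.
  - by move=> t u _; exact: Pstar_ncusp.
  - have -> : (fun s => (q s \o clamp) 0) = x_ by apply/funext => t; case: (qP t).
    exact: cx.
have qy : q zero one = y.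
  apply: lifts_to_uniq ly; exists (q zero); split=> //; by case: (qP zero).
exists (q one); case: (qP one) => lq1 q10; split=> //; rewrite -qy.
apply: (unique_lift bch I_connected cq1 (cst_continuous (x := q zero one))
  _ _ (s := zero)) => //.
- move=> t _ /=; have [[_ ->] _] := qP t; have [[_ ->] _] := qP zero.
  by rewrite F1.
- by move=> t _; have [[_ ->] _] := qP t; exact: Pstar_ncusp.
Qed.

(** A homotopy, with its two parameters exchanged, is a family of paths with fixed end whose lifts
    all start at x. *)
Lemma lifts_to_homotopic (a b : Pstar) (p q : {path I from a to b in Pstar}) x y :
  homotopic p q -> lifts_to p x y -> lifts_to q x y.
Proof.
move=> [H [cH H0 H1 Ha Hb]] lp.
have [hx _] := lifts_to_over lp; rewrite path_zero in hx.
have -> : (q : I -> Pstar) = fun t => H (t, one) by apply/funext => t; rewrite H1.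
apply: (@lifts_to_family (fun st => H (st.2, st.1)) (cst x)) => //=.
- apply: (@continuous_o _ _ _ (fun st : I * I => (st.2, st.1)) H) => //.
  by apply: continuous_pair => ?; [exact: cvg_snd|exact: cvg_fst].
- exact: cst_continuous.
- by move=> s; rewrite Ha.
- by move=> s; rewrite !Hb.
- by have -> : (fun t => H (t, zero)) = p by apply/funext => t; rewrite H0.
Qed.

Lemma rpt_inj (s t : R) : rpt s = rpt t -> s = t.
Proof. by case. Qed.

Lemma rpt_ncusp (t : R) : 0 < t < 1 -> ~ cusps (rpt t).
Proof.
move=> /andP[t0 t1] [[//|[tE]]|[tE]]; first by rewrite tE ltxx in t0.
by rewrite tE ltxx in t1.
Qed.

Lemma rpt_continuous : continuous (@rpt R).
Proof.
apply: (@continuous_o _ _ _ (fun x : R => Complex x 0 : C R) (@fin R)).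
  by apply: continuous_Complex => ?; [exact: cvg_id|exact: cvg_cst].
exact: continuous_fin.
Qed.

Lemma edge_mid (e : edge h) : h (e mid) = rpt 2^-1.
Proof. by rewrite edge_section rv_mid. Qed.

Lemma edge_of_eqfun (e e' : edge h) : e =1 e' -> e = e'.
Proof.
case: e e' => [f cf hf] [g cg hg] /= /funext fg; rewrite -{}fg in cg hg *.
by rewrite (Prop_irrelevance cf cg) (Prop_irrelevance hf hg).
Qed.

(** Unique lifting settles the open interval only, as h may branch over 0 and 1; the two ends follow
    by continuity. *)
Lemma edge_ext (e e' : edge h) : e mid = e' mid -> e = e'.
Proof.
move=> emid; apply: edge_of_eqfun.
have ce : continuous (e \o clamp).
  by apply: continuous_o; [exact: clamp_continuous|exact: edge_continuous].
have ce' : continuous (e' \o clamp).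
  by apply: continuous_o; [exact: clamp_continuous|exact: edge_continuous].
have J : connected [set` `]0 : R, 1[].
  by apply/connected_intervalP; exact: interval_is_interval.
have inner (t : R) : 0 < t < 1 -> e (clamp t) = e' (clamp t).
  move=> t01.
  apply: (unique_lift bch J ce ce' _ _ (s := 2^-1) (t := t)) => //=.
  - by move=> u _; rewrite !edge_section.
  - move=> u; rewrite in_itv/= edge_section => /andP[u0 u1].
    by rewrite clampK ?ltW//; apply: rpt_ncusp; rewrite u0.
  - by rewrite in_itv/=; apply/andP; split; lra.
move=> t; rewrite -(rvK t); have /andP[t0 t1] := rvP t.
apply: contrapT => ne; have [hX _ _ _ _] := bch.
have /nbhs_ballP[d /= d0 dP] := hausdorff_near_neq hX (ce (rv t)) (ce' (rv t)) ne.
pose d' := Num.min (d / 2) (2^-1).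
have [d'0 d'd d'2] : [/\ 0 < d', d' < d & d' <= 2^-1].
  split; first by rewrite lt_min; apply/andP; split; lra.
    by rewrite gt_min; apply/orP; left; lra.
  by rewrite ge_min lexx orbT.
(* Moving slightly from [rv t] towards 1/2 gives an interior parameter at distance less than d. *)
pose u := (1 - d') * rv t + d' * 2^-1.
apply: (dP u); last by apply: inner; rewrite /u; apply/andP; split; nra.
rewrite /ball/= /u ltr_norml; apply/andP; split; nra.
Qed.

(** The two halves of the interval, run from 1/2 outwards, are lifted from x and glued there; s = 1
    and s = -1 select the half. *)
Lemma edge_exists x : h x = rpt 2^-1 -> exists e : edge h, e mid = x.
Proof.
move=> hx.
have side (s : R) : `|s| = 1 -> exists q : R -> X, [/\ continuous q, q 0 = x &
    forall t, 0 <= t <= 1 -> h (q t) = rpt ((1 + s * t) / 2)].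
  move=> s1; apply: (lift_exists (@P1_hausdorff R) bch).
  - apply: (@continuous_o _ _ _ (fun t : R => (1 + s * t) / 2) (@rpt R));
      last exact: rpt_continuous.
    have -> : (fun t => (1 + s * t) / 2) = (fun t : R => (s / 2) * t + 2^-1).
      by apply/funext => t; field.
    by apply: continuous_affine => t; exact: cvg_id.
  - move=> t /andP[t0 t1]; apply: rpt_ncusp.
    have : `|s * t| < 1 by rewrite normrM s1 mul1r ger0_norm.
    by rewrite ltr_norml => /andP[? ?]; apply/andP; split; lra.
  - by rewrite hx mulr0 addr0 mul1r.
have [|q1 [cq1 q10 hq1]] := side 1; first by rewrite normr1.
have [|q2 [cq2 q20 hq2]] := side (-1); first by rewrite normrN1.
pose f (t : I) := if rv t <= 2^-1 then q2 (- 2 * rv t + 1) else q1 (2 * rv t + - 1).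
have cf : continuous f.
  apply: continuous_if.
  - exact: rv_continuous.
  - apply: (@continuous_o _ _ _ (fun t : I => - 2 * rv t + 1) q2) => //.
    by apply: continuous_affine; exact: rv_continuous.
  - apply: (@continuous_o _ _ _ (fun t : I => 2 * rv t + - 1) q1) => //.
    by apply: continuous_affine; exact: rv_continuous.
  - by move=> t ->; rewrite mulNr divff ?pnatr_eq0// addNr subrr q10.
have hf t : h (f t) = rpt (rv t).
  have /andP[t0 t1] := rvP t; rewrite /f; have [t2|t2] := leP (rv t) 2^-1.
    by rewrite hq2; [congr rpt; field|apply/andP; split; lra].
  by rewrite hq1; [congr rpt; field|apply/andP; split; lra].
exists (Edge cf hf) => /=.
by rewrite /f rv_mid lexx mulNr divff ?pnatr_eq0// addNr.
Qed.

Local Notation base := (@base_point R).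

Lemma edge_transport (p : {path I from base to base in Pstar}) (e : edge h) :
  exists e' : edge h, lifts_to p (e mid) (e' mid).
Proof.
have [|y ly] := @lifts_to_exists p (e mid) (@cts_fun _ _ p).
  by rewrite path_zero edge_mid.
have [_] := lifts_to_over ly; rewrite path_one => /edge_exists[e' e'y].
by exists e'; rewrite e'y.
Qed.

(** Transport along the loop and along its reverse are mutually inverse maps of edges, so a
    permutation as in [monodromy_spec] exists and the default value of [rho] is not taken. *)
Lemma rhoP (l : pi1 R base) (e : edge h) :
  lifts_to (repr l) (e mid) (rho h l e mid).
Proof.
have /choice[f fP] := edge_transport (repr l).
have /choice[g gP] := edge_transport (reverse (repr l)).
have fK : cancel f g.
  move=> u; apply: edge_ext; apply: lifts_to_uniq (gP _) _.
  exact: lifts_to_flip (fP u).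
have gK : cancel g f.
  move=> u; apply: edge_ext; apply: lifts_to_uniq (fP _) _.
  have := lifts_to_flip (gP u); congr lifts_to.
  by apply/funext => t /=; rewrite reverseE flipK.
have : monodromy_spec l (rho h l).
  apply: (@xgetPex _ (1%g : Sym (edge h)) [set s | monodromy_spec l s]).
  exists (MkSym fK gK) => u; have [q [lq q0 q1]] := fP u.
  by exists q; split => //; exists mid.
(* The lift ends on the edge at a point over 1/2, which can only be its midpoint. *)
move=> /(_ e)[q [lq q0 [t _ tq]]]; exists q; split=> //; rewrite -tq.
congr (rho h l e _); apply: rv_inj; apply: rpt_inj.
by rewrite rv_mid -(edge_section (rho h l e) t) tq lq.2 path_one.
Qed.

Lemma rho_class (p : {path I from base to base in Pstar}) (e : edge h) :
  lifts_to p (e mid) (rho h (pi1_class p) e mid).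
Proof. by apply: lifts_to_homotopic (rhoP _ e); exact: homotopic_repr. Qed.

Lemma rhoM : {morph rho h : l m / (l * m)%g}.
Proof.
move=> l m; apply: symP => e /=; apply: edge_ext.
apply: lifts_to_uniq (rho_class _ e) _.
by apply: lifts_to_concat; exact: rhoP.
Qed.

End lifting.

(** * Sheets *)

Section sheets.
Variables (R : realType) (X : topologicalType) (h : X -> P1 R).
Hypothesis bch : branched_cover cusps h.
Local Notation I := (I01 R).
Local Notation Pstar := (Pstar R).
Local Notation C := (C R).
Local Notation base := (@base_point R).

Let ch : continuous h. Proof. by case: bch. Qed.

(* The graph of x |-> E x. *)
Definition anchor (x y : X) : Prop :=
  exists2 z : Pstar, set_val z = h x & lifts_to h (alpha z) x y.

Lemma anchor_over x y : anchor x y -> h y = rpt 2^-1.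
Proof. by move=> [z _ /lifts_to_over[_]]; rewrite path_one. Qed.

Lemma anchor_exists x : ~ cusps (h x) -> exists y, anchor x y.
Proof.
move=> nx; have nx' : h x \in ~` cusps by rewrite inE.
pose z : Pstar := exist (fun z => z \in ~` cusps) (h x) nx'.
have [|y ly] := lifts_to_exists bch (x := x) (@alpha_continuous R z).
  by rewrite alpha_zero.
by exists y, z.
Qed.

Lemma anchor_uniq x y y' : anchor x y -> anchor x y' -> y = y'.
Proof.
move=> [z zE ly] [z' z'E ly']; have zz' : z' = z by apply: Pstar_inj; rewrite z'E.
by rewrite zz' in ly'; exact: (lifts_to_uniq bch ly ly').
Qed.

Definition segment (w c : C) (s : R) : C :=
  Complex ((1 - s) * complex.Re w + s * complex.Re c)
          ((1 - s) * complex.Im w + s * complex.Im c).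

Lemma alpha_base : alpha base =1 cst base.
Proof.
move=> t; apply: Pstar_inj.
change (fin (connecting_arc (Defs.coord (rpt 2^-1)) (rv t)) = rpt 2^-1).
rewrite /connecting_arc ifF; last first.
  by apply/negbTE/negP => /andP[_ /orP[]] /=; lra.
by congr fin; congr Complex => /=; ring.
Qed.

Lemma anchor_mid x : h x = rpt 2^-1 -> anchor x x.
Proof.
move=> hx; exists base => //; exists (cst x); split => //; split.
  exact: cst_continuous.
by move=> t; rewrite alpha_base.
Qed.

Lemma continuous_coord (T : topologicalType) (f : T -> P1 R) :
  continuous f -> (forall t, f t <> infty) -> continuous (fun t => Defs.coord (f t)).
Proof.
move=> cf nf t; have [_ _ cc] := @P1_coordinate R (@finite_chart R) (or_introl erefl).
by apply: continuous_comp; [exact: cf|exact: (cc _ (nf t))].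
Qed.

(** The segments from [h (p t)] to the center c form a continuous family with fixed end, so
    [lifts_to_family] carries the end u of the first lift to the last one. *)
Lemma star_lift (S : set (P1 R)) (c : C) (x y u : X)
    (p : {path I from x to y in X}) (a b : I -> Pstar) :
    (forall z, S z -> z <> infty) ->
    (forall z t, S z -> 0 <= t <= 1 -> ~ cusps (fin (segment (Defs.coord z) c t))) ->
    (forall t, S (h (p t))) ->
    (forall t, set_val (a t) = fin (segment (Defs.coord (h x)) c (rv t))) ->
    (forall t, set_val (b t) = fin (segment (Defs.coord (h y)) c (rv t))) ->
  lifts_to h a x u -> lifts_to h b y u.
Proof.
move=> Sfin Sstar Sp aE bE.
have F_subproof (st : I * I) :
    fin (segment (Defs.coord (h (p st.1))) c (rv st.2)) \in ~` cusps.
  by rewrite inE; apply: Sstar; [exact: Sp|exact: rvP].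
pose F (st : I * I) : Pstar := exist (fun z => z \in ~` cusps) _ (F_subproof st).
have chp : continuous (fun t => Defs.coord (h (p t))).
  apply: continuous_coord => [|t]; last exact: Sfin.
  by apply: (@continuous_o _ _ _ p h) => //; exact: cts_fun.
have cRe : continuous (fun t : I * I => complex.Re (Defs.coord (h (p t.1)))).
  apply: (@continuous_o _ _ _ (fun t : I * I => Defs.coord (h (p t.1)))
    (fun z : C => complex.Re z)).
    apply: (@continuous_o _ _ _ fst (fun t => Defs.coord (h (p t)))) => // ?.
    exact: cvg_fst.
  exact: Re_continuous.
have cIm : continuous (fun t : I * I => complex.Im (Defs.coord (h (p t.1)))).
  apply: (@continuous_o _ _ _ (fun t : I * I => Defs.coord (h (p t.1)))
    (fun z : C => complex.Im z)).
    apply: (@continuous_o _ _ _ fst (fun t => Defs.coord (h (p t)))) => // ?.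
    exact: cvg_fst.
  exact: Im_continuous.
have c2 : continuous (fun t : I * I => rv t.2) by exact: continuous_rvsnd.
have clin (f : I * I -> R) (d : R) : continuous f ->
    continuous (fun t : I * I => (1 - rv t.2) * f t + rv t.2 * d).
  move=> cf t; apply: cvgD; apply: cvgM.
  - by apply: cvgB; [exact: cvg_cst|exact: c2].
  - exact: cf.
  - exact: c2.
  - exact: cvg_cst.
have cF : continuous F.
  apply: continuous_comp_initial.
  apply: (@continuous_o _ _ _
    (fun st : I * I => segment (Defs.coord (h (p st.1))) c (rv st.2)) (@fin R)).
    by apply: continuous_Complex; exact: clin.
  exact: continuous_fin.
have -> : a = fun t => F (zero, t).
  apply/funext => t; apply: Pstar_inj; rewrite aE.
  change (fin (segment (Defs.coord (h x)) c (rv t)) =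
          fin (segment (Defs.coord (h (p zero))) c (rv t))).
  by rewrite path_zero.
have -> : b = fun t => F (one, t).
  apply/funext => t; apply: Pstar_inj; rewrite bE.
  change (fin (segment (Defs.coord (h y)) c (rv t)) =
          fin (segment (Defs.coord (h (p one))) c (rv t))).
  by rewrite path_one.
have [p0 p1] : p zero = x /\ p one = y by rewrite path_zero path_one.
rewrite -[in X in lifts_to _ _ X _ -> _]p0 -[in X in _ -> lifts_to _ _ X _]p1 => lx.
apply: (lifts_to_family bch (x_ := p) cF) => //.
- exact: cts_fun.
- move=> s.
  change (h (p s) = fin (segment (Defs.coord (h (p s))) c (rv zero))).
  rewrite /segment rv0 subr0 !mul1r !mul0r !addr0.
  have := Sfin _ (Sp s); case: (h (p s)) => // -[]//.
- move=> s; apply: Pstar_inj.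
  change (fin (segment (Defs.coord (h (p s))) c (rv one)) =
          fin (segment (Defs.coord (h (p zero))) c (rv one))).
  by rewrite /segment rv1 subrr !mul0r.
Qed.

Lemma slit_planeE (a b : R) :
  slit_plane (fin (Complex a b)) <-> b != 0 \/ 0 < a < 1.
Proof.
split=> [nslit|ab [//|[x x01 [aE bE]]]].
  have [b0|] := eqVneq b 0; last by left.
  right; apply: contrapT => /negP; rewrite negb_and -!leNgt => /orP a01.
  by apply: nslit; right; exists a => //; rewrite b0.
case: ab; first by rewrite bE eqxx.
by rewrite aE => /andP[? ?]; case: x01; lra.
Qed.

Lemma slit_ncusp (z : P1 R) : slit_plane z -> ~ cusps z.
Proof.
move=> nz [[zE|zE]|zE]; apply: nz; first by left.
  by right; exists 0; [left|].
by right; exists 1; [right|].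
Qed.

Lemma slit_segment (z : P1 R) (t : R) : slit_plane z -> 0 <= t <= 1 ->
  slit_plane (fin (segment (Defs.coord z) (Complex 2^-1 0) t)).
Proof.
case: z => [[a b]|]; last by move=> nz; exfalso; apply: nz; left.
move=> /slit_planeE ab /andP[t0 t1]; apply/slit_planeE => /=.
have [->|tn1] := eqVneq t 1.
  by right; rewrite subrr !mul0r !add0r mul1r; apply/andP; split; lra.
have {}t1 : t < 1 by rewrite lt_neqAle tn1.
case: ab => [b0|/andP[a0 a1]].
  by left; rewrite mulr0 addr0 mulf_neq0// gt_eqF// subr_gt0.
by right; apply/andP; split; nra.
Qed.

Lemma connecting_arc_slit (z : P1 R) (s : R) : slit_plane z ->
  connecting_arc (Defs.coord z) s = segment (Defs.coord z) (Complex 2^-1 0) s.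
Proof.
move=> nz; rewrite /connecting_arc ifF.
  by rewrite /segment /segment_to_half /= mulr0 addr0.
case: z nz => [[a b]|]; last by move=> nz; exfalso; apply: nz; left.
move=> /slit_planeE ab; apply/negbTE/negP => /andP[/= /eqP b0 ao].
case: ab; first by rewrite b0 eqxx.
by move=> /andP[? ?]; case/orP: ao; lra.
Qed.

Lemma alphaE (z : Pstar) (t : I) :
  set_val (alpha z t) = fin (connecting_arc (Defs.coord (set_val z)) (rv t)) :> P1 R.
Proof. by []. Qed.

(** Over the slit plane every arc to 1/2 is a straight segment, so [star_lift] applies with center
    1/2. *)
Lemma anchor_slit x y u (p : {path I from x to y in X}) :
  (forall t, slit_plane (h (p t))) -> anchor x u -> anchor y u.
Proof.
move=> Sp [z zE lx].
have Sx : slit_plane (h x) by rewrite -[x](@path_zero _ _ _ _ p).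
have Sy : slit_plane (h y) by rewrite -[y](@path_one _ _ _ _ p).
have ny : h y \in ~` cusps by rewrite inE; exact: slit_ncusp.
exists (exist (fun z => z \in ~` cusps) (h y) ny) => //.
apply: (star_lift (c := Complex 2^-1 0) _ _ Sp _ _ lx) => //.
- by move=> w nw wE; apply: nw; left.
- by move=> w t Sw t01; apply: slit_ncusp; exact: slit_segment.
- by move=> t; rewrite alphaE zE connecting_arc_slit.
- by move=> t; rewrite alphaE connecting_arc_slit.
Qed.

Definition upper : set (P1 R) := closed_upper_half_plane `\` cusps.

(** The choice of the upper half-circle matters here: its imaginary part is a sine on [0, pi]. *)
Lemma arc_upper (z : Pstar) (t : I) : closed_upper_half_plane (set_val z) ->
  upper (set_val (alpha z t)).
Proof.
move=> uz; split; last exact: Pstar_ncusp.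
rewrite alphaE /closed_upper_half_plane /= /connecting_arc; case: ifP => _ /=.
  rewrite mulr_ge0// sin_ge0_pi//.
  have /andP[t0 t1] := rvP t; have pi0 := pi_ge0 R.
  by rewrite mulr_ge0//= ler_piMr.
have /andP[t0 t1] := rvP t; rewrite mulr_ge0 ?subr_ge0//.
by move: uz; rewrite -fin_coord.
Qed.

(** As i is strictly above the real axis, a segment towards it leaves the axis at once, even from a
    real starting point. *)
Lemma upper_segment (z : P1 R) (t : R) : upper z -> 0 <= t <= 1 ->
  ~ cusps (fin (segment (Defs.coord z) (Complex 0 1) t)).
Proof.
move=> [+ nz] /andP[t0 t1]; case: z nz => [[a b]|] nz;
  last by exfalso; apply: nz; left; left.
move=> /= b0; have [->|tn0] := eqVneq t 0.
  by rewrite /segment/= subr0 !mul1r !mul0r !addr0.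
have {}t0 : 0 < t by rewrite lt_neqAle eq_sym tn0.
apply/set_mem/fin_Pstar; left => /=; rewrite gt_eqF// mulr1 ltr_wpDl//.
by rewrite mulr_ge0// subr_ge0.
Qed.

Lemma anchor_path x u : anchor x u -> closed_upper_half_plane (h x) ->
  exists p : {path I from x to u in X}, forall t, upper (h (p t)).
Proof.
move=> [z zE [q [[cq hq] q0 q1]]] ux.
by exists (mk_path cq q0 q1) => t; rewrite hq; apply: arc_upper; rewrite zE.
Qed.

(* The arcs [alpha z] do not depend continuously on z in the closed half-plane.
   Instead, the ends u and v are joined by a path over the half-plane, which is
   star-shaped about i, and are then recovered from the common end of the lifts
   of the segment from 1/2 to i. *)
Lemma anchor_upper x y u (p : {path I from x to y in X}) :
  (forall t, upper (h (p t))) -> anchor x u -> anchor y u.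
Proof.
move=> up au.
have [ux _] : upper (h x) by rewrite -[x](@path_zero _ _ _ _ p).
have [uy ny] : upper (h y) by rewrite -[y](@path_one _ _ _ _ p).
have [v av] := anchor_exists ny.
have [q uq] := anchor_path au ux.
have [r ur] := anchor_path av uy.
pose pr := concat (concat (reverse q) p) r.
have upr t : upper (h (pr t)).
  rewrite concatE; case: ifP => _; last exact: ur.
  by rewrite concatE; case: ifP => _; [exact: uq|exact: up].
have hu := anchor_over au; have hv := anchor_over av.
have Su : upper (h u) by rewrite -[u](@path_one _ _ _ _ q).
have a_subproof (t : I) :
    fin (segment (Defs.coord (rpt 2^-1)) (Complex 0 1) (rv t)) \in ~` cusps.
  by rewrite inE -hu; apply: upper_segment => //; exact: rvP.
pose a (t : I) : Pstar := exist (fun z => z \in ~` cusps) _ (a_subproof t).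
have ca : continuous a.
  apply: continuous_comp_initial.
  apply: (@continuous_o _ _ _
    (fun t : I => segment (Defs.coord (rpt 2^-1)) (Complex 0 1) (rv t)) (@fin R)).
    have clin (d e : R) : continuous (fun t : I => (1 - rv t) * d + rv t * e).
      have -> : (fun t : I => (1 - rv t) * d + rv t * e) =
          fun t => (e - d) * rv t + d by apply/funext => t; ring.
      by apply: continuous_affine; exact: rv_continuous.
    by apply: continuous_Complex; exact: clin.
  exact: continuous_fin.
have [|w lw] := lifts_to_exists bch (x := u) ca.
  rewrite hu; change (rpt 2^-1 =
    fin (segment (Defs.coord (rpt 2^-1)) (Complex 0 1) (rv zero)) :> P1 R).
  by rewrite /segment rv0 subr0 !mul1r !mul0r !addr0.
have lw' : lifts_to h a v w.
  apply: (star_lift (S := upper) (c := Complex 0 1) (p := pr) (a := a)) => //.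
  - by move=> ? [_ nz] zE; apply: nz; left; left.
  - exact: upper_segment.
  - by move=> t; rewrite hu.
  - by move=> t; rewrite hv.
by rewrite (lifts_to_inj bch lw lw').
Qed.

(** The anchor is constant on each of the two components forming the sheet, and their common point
    forces the two constants to agree. *)
Lemma sheet_anchor (S : set X) : is_sheet h S ->
  exists u, forall x, S x -> anchor x u.
Proof.
move=> [B [T [[b Sb BE] [t [St nt] TE] [m [Bm Tm]] SE]]].
have [u bu] := anchor_exists (slit_ncusp Sb).
have [v tv] := anchor_exists nt.
have aB x : B x -> anchor x u.
  by rewrite BE => -[p Sp]; exact: anchor_slit Sp bu.
have aT x : T x -> anchor x v.
  by rewrite TE => -[p Sp]; exact: anchor_upper Sp tv.
have uv : u = v by apply: anchor_uniq (aB _ Bm) (aT _ Tm).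
by exists u => x; rewrite SE => -[[/aB//|/aT]]; rewrite -uv.
Qed.

(** This replaces sheets by lifts of arcs. One way, the midpoint of e lies in the sheet and is its
    own anchor; the other way, a sheet is built around that midpoint. *)
Lemma edge_of_sheet_atP (x : X) (e : edge h) :
  edge_of_sheet_at x e <-> anchor x (e mid).
Proof.
split=> [[S [shS Sx eS]]|ax].
  have [u uP] := sheet_anchor shS.
  have Se : S (e mid) by apply: eS; rewrite rv_mid; apply/andP; split; lra.
  by rewrite (anchor_uniq (anchor_mid (edge_mid e)) (uP _ Se)); exact: uP.
have hm := edge_mid e.
have Sm : slit_plane (h (e mid)).
  by rewrite hm; apply/slit_planeE; right; apply/andP; split; lra.
have Um : upper (h (e mid)) by split; [rewrite hm/=|exact: slit_ncusp].
pose B := path_component R (h @^-1` slit_plane) (e mid).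
pose T := path_component R (h @^-1` upper) (e mid).
exists ((B `|` T) `\` h @^-1` cusps); split.
- exists B, T; split => //; [by exists (e mid)|by exists (e mid)|].
  by exists (e mid); split; exists (cst_path (x := e mid)).
- have [z zE [q [[cq hq] q0 q1]]] := ax.
  split; last by rewrite /preimage/= -zE; exact: Pstar_ncusp.
  (* The lifted arc joins x to the midpoint over the slit plane if x lies over it; otherwise [h x]
     is real and the arc stays in the closed upper half-plane. *)
  have [Sx|nSx] := pselect (slit_plane (h x)).
    left; exists (reverse (mk_path cq q0 q1)) => t; rewrite reverseE /preimage/=.
    rewrite hq alphaE zE connecting_arc_slit//.
    by apply: slit_segment => //; exact: rvP.
  right; exists (reverse (mk_path cq q0 q1)) => t; rewrite reverseE /preimage/=.
  rewrite hq; apply: arc_upper; rewrite zE.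
  by move/contrapT: nSx => [->//|[w _ ->]] /=.
- move=> t t01.
  have het : h (e t) = rpt (rv t) by exact: edge_section.
  split; last by rewrite /preimage/= het; exact: rpt_ncusp.
  left.
  pose f (s : I) := e (clamp ((rv t - 2^-1) * rv s + 2^-1)).
  have cf : continuous f.
    apply: (@continuous_o _ _ _ (fun s : I => clamp ((rv t - 2^-1) * rv s + 2^-1)) e);
      last exact: edge_continuous.
    by apply: continuous_clamp; apply: continuous_affine; exact: rv_continuous.
  have f0 : f zero = e mid by rewrite /f rv0 mulr0 add0r.
  have f1 : f one = e t by rewrite /f rv1 mulr1 subrK rvK.
  exists (mk_path cf f0 f1) => s; rewrite /preimage/=.
  have /andP[s0 s1] := rvP s; case/andP: t01 => t0 t1.
  change (slit_plane (h (f s))).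
  rewrite /f edge_section clampK; last by apply/andP; split; nra.
  by apply/slit_planeE; right; apply/andP; split; nra.
Qed.

End sheets.

(** * The edges of a composition *)

Lemma wreath_actM (E F : Type) (v w : wreath F (Sym E)) (p : E * F) :
  wreath_act (v * w)%g p = wreath_act w (wreath_act v p).
Proof. by case: p. Qed.

(** The element [e0] makes the permutation of F visible: on an empty product it could not be
    recovered. *)
Lemma wreath_act_faithful (E F : Type) (e0 : E) (v w : wreath F (Sym E)) :
  wreath_act v =1 wreath_act w -> v = w.
Proof.
move=> vw; apply: wreathP => [f|].
  by apply: symP => e; have [] := vw (e, f).
by apply: symP => f; have [] := vw (e0, f).
Qed.

Lemma morph_one (G H : groupType) (f : G -> H) :
  {morph f : x y / (x * y)%g} -> f 1%g = 1%g.
Proof. by move=> fM; apply: (mulgI (f 1%g)); rewrite -fM !mulg1. Qed.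

Section composition.
Variables (R : realType) (X : topologicalType).
Variables (beta : P1 R -> P1 R) (gamma : X -> P1 R).
Hypotheses (bbeta : branched_cover cusps beta) (bgamma : branched_cover cusps gamma).
Hypothesis beta_cusps : beta @` cusps `<=` cusps.
Local Notation I := (I01 R).
Local Notation Pstar := (Pstar R).
Local Notation base := (@base_point R).

Let bcomp : branched_cover cusps (beta \o gamma).
Proof. exact: branched_cover_comp. Qed.

Let beta_ncusp z : ~ cusps (beta z) -> ~ cusps z.
Proof. by move=> nbz cz; apply: nbz; apply: beta_cusps; exists z. Qed.

Lemma half_ncusp : ~ cusps (@rpt R 2^-1).
Proof. by apply: rpt_ncusp; apply/andP; split; lra. Qed.

(** A lift by [beta] of a loop avoiding the cusps avoids them too, because [beta] sends cusps to
    cusps; it is thus a path in [Pstar], and the default value is not taken. *)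
Lemma extending_patternP (l : pi1 R base) (e : edge beta) :
  exists (a b : Pstar) (q : {path I from a to b in Pstar}),
    [/\ is_lift beta (repr l) (fun t => set_val (q t)),
        set_val (q zero) = e mid & extending_pattern l e = pi1_class (loop_of q)].
Proof.
apply: (@xgetPex _ 1%g [set c |
  exists (a b : Pstar) (q : {path I from a to b in Pstar}),
    [/\ is_lift beta (repr l) (fun t => set_val (q t)),
        set_val (q zero) = e mid & c = pi1_class (loop_of q)]]).
have [y [q [[cq hq] q0 _]]] : exists y, lifts_to beta (repr l) (e mid) y.
  apply: lifts_to_exists => //; first exact: cts_fun.
  by rewrite path_zero edge_mid.
have nq t : q t \in ~` cusps.
  by rewrite inE; apply: beta_ncusp; rewrite hq; exact: Pstar_ncusp.
pose r (t : I) : Pstar := exist (fun z => z \in ~` cusps) _ (nq t).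
have cr : continuous r by apply: continuous_comp_initial; exact: cq.
pose r' := mk_path cr erefl erefl.
by exists (pi1_class (loop_of r')), (r zero), (r one), r'; split.
Qed.

Fact compose_edge_continuous (e : edge (beta \o gamma)) :
  continuous (gamma \o e).
Proof.
apply: continuous_o; first exact: edge_continuous.
by have [_ _ cg _ _] := bgamma.
Qed.

Fact compose_edge_section (e : edge (beta \o gamma)) (t : I) :
  beta ((gamma \o e) t) = rpt (rv t).
Proof. exact: (edge_section e t). Qed.

Definition compose_edge (e : edge (beta \o gamma)) : edge beta :=
  Edge (@compose_edge_continuous e) (compose_edge_section e).

Lemma edge_comp_ncusp (e : edge (beta \o gamma)) : ~ cusps (gamma (e mid)).
Proof.
by apply: beta_ncusp; have /= -> := edge_mid e; exact: half_ncusp.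
Qed.

Lemma anchor_edge (e : edge (beta \o gamma)) :
  exists e' : edge gamma, anchor gamma (e mid) (e' mid).
Proof.
have [y ay] := anchor_exists bgamma (@edge_comp_ncusp e).
have [e' e'y] := edge_exists bgamma (anchor_over ay).
by exists e'; rewrite e'y.
Qed.

Definition edge_pair : edge (beta \o gamma) -> edge gamma * edge beta :=
  fun e => (projT1 (cid (anchor_edge e)), compose_edge e).

Lemma edge_pairP (e : edge (beta \o gamma)) :
  anchor gamma (e mid) ((edge_pair e).1 mid).
Proof. exact: (projT2 (cid (anchor_edge e))). Qed.

Lemma edge_pair_identification : edge_identification edge_pair.
Proof.
move=> e; split=> // e'; split => [/(edge_of_sheet_atP bgamma) ae'|->].
  apply: (edge_ext bgamma); apply: (anchor_uniq bgamma ae').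
  exact: edge_pairP.
by apply/(edge_of_sheet_atP bgamma); exact: edge_pairP.
Qed.

(** Equal second components give the same arc in the sphere; its lifts by [gamma] then have equal
    ends, hence equal starts. *)
Lemma edge_pair_inj : injective edge_pair.
Proof.
move=> e f ef; apply: (edge_ext bcomp).
have gef : gamma (e mid) = gamma (f mid).
  by have := congr1 (fun p : edge gamma * edge beta => p.2 mid) ef.
have [z zE le] := edge_pairP e; have [w wE lf] := edge_pairP f.
have zw : w = z by apply: Pstar_inj; rewrite wE zE.
by rewrite -ef zw in lf; exact: (lifts_to_inj bgamma le lf).
Qed.

(** The midpoint of the preimage is found by lifting, from the midpoint of [e], the reversed arc
    from 1/2 to [f mid]. *)
Lemma edge_pair_surj p : exists e, edge_pair e = p.
Proof.
case: p => e f.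
have nf : f mid \in ~` cusps.
  by rewrite inE; apply: beta_ncusp; rewrite edge_mid; exact: half_ncusp.
pose z : Pstar := exist (fun z => z \in ~` cusps) (f mid) nf.
have cz : continuous (alpha_fun z \o flip).
  by apply: continuous_o; [exact: flip_continuous|exact: alpha_continuous].
have [|x /lifts_to_flip lx] := lifts_to_exists bgamma (x := e mid) cz.
  by rewrite /= flip0 alpha_one edge_mid.
have {}lx : lifts_to gamma (alpha z) x (e mid).
  move: lx; congr lifts_to; apply/funext => t /=; by rewrite flipK.
have gx : gamma x = f mid by have [-> _] := lifts_to_over lx; rewrite path_zero.
have [|d dx] := @edge_exists _ _ _ bcomp x; first by rewrite /= gx edge_mid.
exists d; rewrite /edge_pair; congr pair.
  apply: (edge_ext bgamma); apply: (anchor_uniq bgamma (edge_pairP d)).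
  by rewrite dx; exists z.
by apply: (edge_ext bbeta); rewrite /= dx.
Qed.

Lemma edge_pair_rho (l : pi1 R base) (e : edge (beta \o gamma)) :
  edge_pair (rho (beta \o gamma) l e) =
  wreath_act (wreath_map (rho gamma) (extended_monodromy beta l)) (edge_pair e).
Proof.
have [r [[cr hr] r0 r1]] := rhoP bcomp l e.
have [a [b [q [lq q0 qE]]]] := extending_patternP l (compose_edge e).
have lgr : is_lift beta (repr l) (gamma \o r).
  by split => //; apply: continuous_o => //; case: bgamma.
have gr : gamma \o r =1 (fun t => set_val (q t)).
  by apply: (is_lift_uniq bbeta lgr lq (s := zero)); rewrite /= r0 q0.
rewrite /wreath_act /=; congr pair.
  apply: (edge_ext bgamma).
  have [z zE lz] := edge_pairP e.
  have [w wE lw] := edge_pairP (rho (beta \o gamma) l e).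
  have za : z = a.
    by apply: Pstar_inj; rewrite zE -r0; have /= -> := gr zero; rewrite path_zero.
  have wb : w = b.
    by apply: Pstar_inj; rewrite wE -r1; have /= -> := gr one; rewrite path_one.
  rewrite za in lz; rewrite wb in lw.
  have lq' : lifts_to gamma q (e mid) (rho (beta \o gamma) l e mid) by exists r.
  have := rho_class bgamma (loop_of q) (projT1 (cid (anchor_edge e))).
  (* The three lifts follow the bracketing of [loop_of]: back along the first arc, along r, then
     along the second arc. *)
  rewrite -qE; apply: (lifts_to_uniq bgamma).
  apply: lifts_to_concat lw; apply: lifts_to_concat lq'.
  exact: lifts_to_flip lz.
apply: (edge_ext bbeta).
apply: (lifts_to_uniq bbeta) (rhoP bbeta l (compose_edge e)).
by exists (gamma \o r); split => //=; [rewrite r0|rewrite r1].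
Qed.

(** A map with values in the three cusps alone would be locally constant, hence constant; from a
    point over a non-cusp value, the arc to 1/2 leads to an edge. *)
Lemma edge_exists_of_connected :
    connected [set: X] -> (exists x y, gamma x <> gamma y) ->
  inhabited (edge gamma).
Proof.
move=> conX [x0 [y0 xy]].
have [x nx] : exists x, ~ cusps (gamma x).
  apply: contrapT => /forallNP allc; apply: xy; symmetry.
  apply: (@connected_ind _ setT (fun x => gamma x = gamma x0) conX _ x0 y0) => // u _.
  have sep d : \forall v \near u, gamma v = d -> gamma u = d.
    have [ud|ud] := pselect (gamma u = d); first by apply: nearW.
    have : nbhs u (gamma @^-1` [set z | z <> d]).
      have [_ _ cg _ _] := bgamma.
      apply: cg; apply: open_nbhs_nbhs; split; last exact: ud. exact: P1_open_neq.
    by apply: filterS => v /= vd /vd.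
  have gu : \forall v \near u, gamma v = gamma u.
    apply: filterS (filterI (filterI (sep infty) (sep (fin 0))) (sep (fin 1))) => v /=.
    move=> [[si s0] s1]; have /contrapT[[c|c]|c] := allc v.
    - by rewrite c si.
    - by rewrite c s0.
    - by rewrite c s1.
  by exists [set v | gamma v = gamma u] => // v w -> ->.
have [y ay] := anchor_exists bgamma nx.
by have [e _] := edge_exists bgamma (anchor_over ay).
Qed.

End composition.

Theorem theorem4p6 (R : realType) (X : topologicalType) (A : set (chart R X))
    (beta : P1 R -> P1 R) (gamma : X -> P1 R) :
  compact_riemann_surface A -> dynamical_belyi beta -> belyi A gamma ->
  let phi : pi1 R (@base_point R) -> wreath (edge beta) (Sym (edge gamma)) :=
    wreath_map (rho gamma) \o extended_monodromy beta in
  [/\ {morph phi : l m / (l * m)%g},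
      forall l, wreath_set (Mon gamma) (Mon beta) (phi l),
      exists iota : edge (beta \o gamma) -> edge gamma * edge beta,
        [/\ edge_identification iota, bijective iota &
            forall l e, iota (rho (beta \o gamma) l e) =
                        wreath_act (phi l) (iota e)],
      group_kernel phi = group_kernel (rho (beta \o gamma)) &
      exists F : Sym (edge (beta \o gamma)) ->
                 wreath (edge beta) (Sym (edge gamma)),
        set_bij (Mon (beta \o gamma)) (range phi) F /\
        {in Mon (beta \o gamma) &, {morph F : s t / (s * t)%g}}].
Proof.
move=> [[[hX conX] Achart Acov _] cX] [bbelyi bcusps] gbelyi phi.
have Acoord a : A a -> coordinate a by case/Achart.
have bgamma := belyi_branched_cover hX conX cX Acoord Acov gbelyi.
have P1cov (x : P1 R) : exists2 a, @P1_atlas R a & cdom a x.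
  case: x => [w|]; first by exists (@finite_chart R) => //; left.
  by exists (@infinite_chart R) => //; right.
have bbeta := belyi_branched_cover (@P1_hausdorff R) (@P1_connected R)
  (@P1_compact R) (@P1_coordinate R) P1cov bbelyi.
have bcomp := branched_cover_comp bbeta bgamma bcusps.
have [e0] : inhabited (edge gamma).
  by apply: (edge_exists_of_connected bgamma conX); case: gbelyi.
pose iota := edge_pair bgamma bcusps.
have iotaE l e : iota (rho (beta \o gamma) l e) = wreath_act (phi l) (iota e).
  exact: edge_pair_rho.
have /choice[j iK] := edge_pair_surj bbeta bgamma bcusps.
(* By equivariance and faithfulness, both homomorphisms identify the same loops; the claims on
   kernels and images rest on this. *)
have phi_rho l m : phi l = phi m <-> rho (beta \o gamma) l = rho (beta \o gamma) m.
  split=> lm.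
    apply: symP => e; apply: (@edge_pair_inj _ _ _ _ bbeta bgamma bcusps).
    by rewrite -/iota !iotaE lm.
  apply: (wreath_act_faithful e0) => p.
  by rewrite -(iK p) -/iota -!iotaE lm.
(* Multiplicativity is read off the faithful action, without computing the extending pattern of a
   product of loops. *)
have phiM : {morph phi : l m / (l * m)%g}.
  move=> l m; apply: (wreath_act_faithful e0) => p.
  by rewrite wreath_actM -(iK p) -/iota -!iotaE (rhoM bcomp).
split=> //.
- move=> l; split=> [e|]; first by exists (extending_pattern l e).
  by exists l.
- exists iota; split => //; first exact: edge_pair_identification.
  exists j => // e; apply: (@edge_pair_inj _ _ _ _ bbeta bgamma bcusps).
  exact: iK.
- apply/seteqP; split=> l; rewrite /group_kernel/=.
    by rewrite -(morph_one phiM) -(morph_one (rhoM bcomp)) phi_rho.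
  by rewrite -(morph_one phiM) -(morph_one (rhoM bcomp)) phi_rho.
(* A loop with given monodromy; by [phi_rho] its image under [phi] does not depend on the choice.
   Outside of the monodromy group the default loop is irrelevant. *)
pose pick s := xget 1%g [set l | rho (beta \o gamma) l = s].
have pickP l : rho (beta \o gamma) (pick (rho (beta \o gamma) l)) =
    rho (beta \o gamma) l.
  apply: (@xgetPex _ _ [set m | rho (beta \o gamma) m = rho (beta \o gamma) l]).
  by exists l.
have FE l : phi (pick (rho (beta \o gamma) l)) = phi l by apply/phi_rho.
exists (phi \o pick); split.
  split.
  - by move=> _ [l _ <-] /=; exists l.
  - by move=> s t /set_mem[l _ <-] /set_mem[m _ <-] /=; rewrite !FE => /phi_rho.
  - by move=> _ [l _ <-]; exists (rho (beta \o gamma) l); [exists l|exact: FE].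
move=> s t /set_mem[l _ <-] /set_mem[m _ <-] /=.
by rewrite -(rhoM bcomp) !FE phiM.
Qed.
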